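(* Let $p$ be a prime, $S$ a finite $p$-group, $\mathcal{F}$ a saturated fusion system on $S$, and $\mathcal{L}$ a centric linking system associated to $\mathcal{F}$. Let $\mathfrak{I}$ be the set of nonextendable isomorphisms of $\mathcal{L}$, with its natural $(S,S)$-biset structure. Then $\mathfrak{I}$ is an $\mathcal{F}$-centric characteristic biset. Moreover, it is the unique minimal $\mathcal{F}$-centric characteristic biset (i.e. up to isomorphism it is contained in every $\mathcal{F}$-centric characteristic biset), and thus $\mathfrak{I}$ is isomorphic, as an $(S,S)$-biset, to the $\mathcal{F}$-centric part of the minimal $\mathcal{F}$-characteristic biset $\Lambda_{\mathcal{F}}$.
   Context: Fusion systems and saturation are in the usual sense (Puig; Broto-Levi-Oliver). $\mathcal{F}(P,Q)$ denotes the set of $\mathcal{F}$-morphisms $P\to Q$ for $P,Q\le S$. A subgroup $P\le S$ is $\mathcal{F}$-centric if $C_S(Q)\le Q$ for every $Q$ that is $\mathcal{F}$-isomorphic to $P$. A centric linking system associated to $\mathcal{F}$ is a category $\mathcal{L}$ whose objects are the $\mathcal{F}$-centric subgroups of $S$, with functors $\delta\colon\mathcal{T}\to\mathcal{L}$ and $\pi\colon\mathcal{L}\to\mathcal{F}$ that are the identity on objects, where $\mathcal{T}$ has the same objects, morphism sets $N_S(P,Q)=\{g\in S\mid gPg^{-1}\le Q\}$ and composition given by multiplication in $S$, such that: (A) for all objects $P,Q$, the group $Z(P)$ acts freely on $\mathcal{L}(P,Q)$ by precomposition via $\delta$, and $\pi$ induces a bijection $\mathcal{L}(P,Q)/Z(P)\to\mathcal{F}(P,Q)$;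 (B) $\pi(\delta(g))=c_g$ (conjugation $x\mapsto gxg^{-1}$) for $g\in N_S(P,Q)$; (C) for $\mathfrak{g}\in\mathcal{L}(P,Q)$ and $x\in P$, $\mathfrak{g}\circ\delta(x)=\delta(\pi(\mathfrak{g})(x))\circ\mathfrak{g}$. Elements of $N_S(P,Q)$ are identified with their images in $\mathcal{L}(P,Q)$. For $P\le\widetilde P$ and $Q\le\widetilde Q$, a morphism $\widetilde{\mathfrak{g}}\in\mathcal{L}(\widetilde P,\widetilde Q)$ extends $\mathfrak{g}\in\mathcal{L}(P,Q)$ if $\widetilde{\mathfrak{g}}\circ\delta_{P,\widetilde P}(1)=\delta_{Q,\widetilde Q}(1)\circ\mathfrak{g}$. An isomorphism $\mathfrak{g}\in\mathcal{L}(P,Q)$ is nonextendable if it has no extension to an isomorphism of $\mathcal{L}$ whose source properly contains $P$. The $(S,S)$-biset structure on $\mathfrak{I}$ is: for a nonextendable isomorphism $\mathfrak{g}\colon P\to Q$ and $a,b\in S$, $a\cdot\mathfrak{g}\cdot b$ is the composite $b^{-1}Pb\xrightarrow{b}P\xrightarrow{\mathfrak{g}}Q\xrightarrow{a}aQa^{-1}$ in $\mathcal{L}$ (which is again nonextendable). All bisets are finite. An $(S,S)$-biset is a finite set $\Omega$ with a free left $S$-action and a free right $S$-action that commute; equivalently a left $(S\times S)$-set via $(b,a)\cdot\omega=b\cdot\omega\cdot a^{-1}$ on which $S\times 1$ and $1\times S$ act freely. For $P\le S$ and an injective homomorphism $\varphi\colon P\to S$, write $(P,\varphi)=\{(\varphi(a),a)\mid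 a\in P\}\le S\times S$, and $[P,\varphi]=S\times_{(P,\varphi)}S\cong(S\times S)/(P,\varphi)$. Every point-stabilizer in an $(S,S)$-biset has the form $(P,\varphi)$. $\Omega^{(P,\varphi)}$ denotes the set of points fixed by $(P,\varphi)$; $\iota_P^S\colon P\to S$ is the inclusion. $\Omega$ is $\mathcal{F}$-generated if every point-stabilizer is of the form $(P,\varphi)$ with $\varphi\in\mathcal{F}(P,S)$. $\Omega$ is $\mathcal{F}$-stable if for every $P\le S$, injective homomorphism $\varphi\colon P\to S$, and $\mathcal{F}$-isomorphisms $\eta_1\colon Q\to P$ and $\eta_2\colon\varphi(P)\to R$, one has $|\Omega^{(P,\varphi)}|=|\Omega^{(Q,\eta_2\varphi\eta_1)}|$. $\Omega$ is $\mathcal{F}$-characteristic if it is $\mathcal{F}$-generated, $\mathcal{F}$-stable, and $|\Omega|/|S|\not\equiv 0\pmod p$. Every saturated $\mathcal{F}$ has a unique (up to isomorphism) minimal $\mathcal{F}$-characteristic biset $\Lambda_{\mathcal{F}}$, meaning one that is, up to isomorphism, contained in every $\mathcal{F}$-characteristic biset. An $\mathcal{F}$-centric characteristic biset is an $\mathcal{F}$-generated $(S,S)$-biset $\Omega$, all of whose point-stabilizers are of the form $(P,\varphi)$ with $P$ $\mathcal{F}$-centric, such that $|\Omega^{(P,\varphi)}|=|\Omega^{(P,\iota_P^S)}|=|\Omega^{(\varphi(P),\varphi^{-1})}|$ for all $\mathcal{F}$-centric $P$ and $\varphi\in\mathcal{F}(P,S)$, and $|\Omega|/|S|\not\equiv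 0\pmod p$. The $\mathcal{F}$-centric part of an $\mathcal{F}$-generated biset is obtained by removing all orbits isomorphic to $[Q,\psi]$ with $Q$ not $\mathcal{F}$-centric. *)

(* Defs.v *)
From HB Require Import structures.
From mathcomp Require Import all_boot all_fingroup all_solvable.

Set Implicit Arguments.
Unset Strict Implicit.
Unset Printing Implicit Defensive.

Import GroupScope.

(* The ambient p-group is a whole [finGroupType] [S], so that its subgroups
   are the terms of [{group S}].  Since [x ^ g] is [g^-1 * x * g] in MathComp,
   the conjugation c_g : x |-> g x g^-1 is [x ^ g^-1]. *)

Section Homomorphisms.
Variable S : finGroupType.
Implicit Types (P Q R : {group S}) (f g : {ffun S -> S}).

(* Injective homomorphisms P -> Q.  A homomorphism out of P is represented by
   the function on all of S that takes the value 1 outside P; two such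
   homomorphisms are then equal iff the functions are, composition is
   composition of functions, and enlarging the codomain does not change the
   function. *)
Definition injhom P Q : {set {ffun S -> S}} :=
  [set f : {ffun S -> S} |
    [&& [forall x in P, forall y in P, f (x * y) == f x * f y],
        [forall x in P, forall y in P, (f x == f y) ==> (x == y)],
        f @: P \subset Q
      & [forall x, (x \notin P) ==> (f x == 1)]]].

Definition hcomp g f : {ffun S -> S} := [ffun x => g (f x)].

(* The identity of P, and also the inclusion of P in any larger subgroup. *)
Definition hincl (P : {set S}) : {ffun S -> S} :=
  [ffun x => if x \in P then x else 1].

Definition hconj (P : {set S}) (g : S) : {ffun S -> S} :=
  [ffun x => if x \in P then x ^ g^-1 else 1].

(* The inverse f(P) -> P of an injective homomorphism f on P. *)
Definition hinv (P : {set S}) f : {ffun S -> S} :=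
  [ffun y => odflt 1 [pick x in P | f x == y]].

(* N_S(P, Q) *)
Definition transporter (P Q : {set S}) : {set S} :=
  [set g | P :^ g^-1 \subset Q].

(* The isomorphisms P -> Q of a category with morphism sets [F]. *)
Definition isos (F : {group S} -> {group S} -> {set {ffun S -> S}}) P Q :=
  [set f in F P Q |
    [exists g in F Q P, (hcomp g f == hincl P) && (hcomp f g == hincl Q)]].

End Homomorphisms.

Record fusion_system (S : finGroupType) := FusionSystem {
  fhom :> {group S} -> {group S} -> {set {ffun S -> S}};
  fhom_inj : forall P Q, fhom P Q \subset injhom P Q;
  fhom_conj : forall (P Q : {group S}) g, g \in transporter P Q -> hconj P g \in fhom P Q;
  fhom_comp : forall P Q R f g,
    f \in fhom P Q -> g \in fhom Q R -> hcomp g f \in fhom P R;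
  (* every morphism is an isomorphism followed by an inclusion *)
  fhom_factor : forall (P Q : {group S}) f,
    f \in fhom P Q -> exists2 R : {group S}, R \subset Q & f \in isos fhom P R
}.

Section Fusion.
Variables (S : finGroupType) (F : fusion_system S).
Implicit Types (P Q R : {group S}) (f : {ffun S -> S}).

Definition fisomorphic P Q : bool := [exists f, f \in isos F P Q].

Definition centric P : bool :=
  [forall Q : {group S}, fisomorphic P Q ==> ('C(Q) \subset Q)].

Definition fully_normalized P : bool :=
  [forall Q : {group S}, fisomorphic P Q ==> (#|'N(Q)| <= #|'N(P)|)].

Definition fully_centralized P : bool :=
  [forall Q : {group S}, fisomorphic P Q ==> (#|'C(Q)| <= #|'C(P)|)].

Definition AutF P : {set {perm S}} :=
  [set a in Aut P | [ffun x => if x \in P then a x else 1] \in F P P].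

Definition AutS P : {set {perm S}} := conj_aut P @* 'N(P).

(* N_f is the set of g in N_S(P) such that f c_g f^-1 is an element of
   Aut_S(f(P)). *)
Definition Nphi P f : {set S} :=
  [set g in 'N(P) | [exists h in 'N(f @: P),
     [forall x in P, f (x ^ g^-1) == f x ^ h^-1]]].

Lemma in_Nphi P f g :
  (g \in Nphi P f) = (g \in 'N(P)) && [exists h in 'N(f @: P),
     [forall x in P, f (x ^ g^-1) == f x ^ h^-1]].
Proof. by rewrite /Nphi inE. Qed.

Lemma Nphi_group_set P f : group_set (Nphi P f).
Proof.
apply/group_setP; split.
  rewrite in_Nphi group1 /=; apply/existsP; exists 1; rewrite group1 /=.
  by apply/forall_inP=> x _; rewrite invg1 !conjg1.
move=> g1 g2; rewrite !in_Nphi.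
case/andP=> N1 /existsP[h1 /andP[M1 /forall_inP E1]].
case/andP=> N2 /existsP[h2 /andP[M2 /forall_inP E2]].
rewrite groupM //=; apply/existsP; exists (h1 * h2); rewrite groupM //=.
apply/forall_inP=> x Px; rewrite !invMg !conjgM.
have Px2 : x ^ g2^-1 \in P by rewrite memJ_norm ?groupV.
by rewrite (eqP (E1 _ Px2)) (eqP (E2 _ Px)).
Qed.

Canonical Nphi_group P f := Group (Nphi_group_set P f).

(* The axioms of Broto, Levi and Oliver; Q stands for f(P). *)
Definition saturated (p : nat) : Prop :=
  (forall P, fully_normalized P ->
     fully_centralized P /\ p.-Sylow(AutF P) (AutS P)) /\
  (forall P Q f, f \in F P [set: S]%G -> f @: P = Q -> fully_centralized Q ->
     exists2 h : {ffun S -> S},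
       h \in F (Nphi_group P f) [set: S]%G & {in P, h =1 f}).

Lemma injhom1 (P Q : {group S}) f : f \in injhom P Q -> f 1 = 1.
Proof.
rewrite inE => /and4P[/forall_inP fM _ _ _].
have /forall_inP/(_ 1 (group1 P))/eqP := fM 1 (group1 P).
by rewrite mulg1 => e; apply: (mulgI (f 1)); rewrite -e mulg1.
Qed.

Lemma injhom_sub (P Q : {group S}) f x : f \in injhom P Q -> x \in P -> f x \in Q.
Proof.
by rewrite inE => /and4P[_ _ /subsetP s _] Px; apply/s/imset_f.
Qed.

Lemma injhom_out (P Q : {group S}) f x :
  f \in injhom P Q -> x \notin P -> f x = 1.
Proof. by rewrite inE => /and4P[_ _ _ /forallP/(_ x)/implyP o] /o/eqP. Qed.

Lemma isos_comp P Q R (f g : {ffun S -> S}) :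
  f \in isos F P Q -> g \in isos F Q R -> hcomp g f \in isos F P R.
Proof.
rewrite !inE => /andP[Ff /existsP[f' /and3P[Ff' /eqP e1 /eqP e2]]].
case/andP=> Fg /existsP[g' /and3P[Fg' /eqP e3 /eqP e4]].
rewrite (fhom_comp Ff Fg) /=; apply/existsP; exists (hcomp f' g').
rewrite (fhom_comp Fg' Ff') /=.
have If := subsetP (fhom_inj F _ _) _ Ff.
have Ig' := subsetP (fhom_inj F _ _) _ Fg'.
apply/andP; split; apply/eqP/ffunP=> x; rewrite !ffunE.
  have /ffunP/(_ (f x)) := e3; rewrite !ffunE => ->.
  have /ffunP/(_ x) := e1; rewrite !ffunE => <-.
  case: ifP => // /negbT nQ; case: (boolP (x \in P)) => [Px|nP].
    by rewrite (injhom_sub If Px) in nQ.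
  by rewrite (injhom_out If nP).
have /ffunP/(_ (g' x)) := e2; rewrite !ffunE => ->.
have /ffunP/(_ x) := e4; rewrite !ffunE => <-.
case: ifP => // /negbT nQ; case: (boolP (x \in R)) => [Rx|nR].
  by rewrite (injhom_sub Ig' Rx) in nQ.
by rewrite (injhom_out Ig' nR).
Qed.

Lemma transporterJ (P : {set S}) a : a \in transporter P (P :^ a^-1).
Proof. by rewrite inE. Qed.

Lemma isos_conj P a : hconj P a \in isos F P (P :^ a^-1)%G.
Proof.
rewrite inE fhom_conj ?transporterJ //=; apply/existsP.
exists (hconj (P :^ a^-1) a^-1); apply/andP; split.
  by apply: fhom_conj; rewrite inE /= -conjsgM invgK mulVg conjsg1.
apply/andP; split; apply/eqP/ffunP=> x; rewrite !ffunE.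
  case: (boolP (x \in P)) => Px; last by rewrite conj1g if_same.
  by rewrite memJ_conjg Px invgK -conjgM mulVg conjg1.
rewrite mem_conjg !invgK; case: (boolP (x ^ a \in P)) => Px.
  by rewrite Px -conjgM mulgV conjg1.
by rewrite conj1g if_same.
Qed.

Lemma centricJ P a : centric P -> centric (P :^ a)%G.
Proof.
move=> /forallP cP; apply/forallP=> Q; apply/implyP=> /existsP[f isoQ].
apply: (implyP (cP Q)); apply/existsP; exists (hcomp f (hconj P a^-1)).
by apply: isos_comp isoQ; rewrite -{2}[a]invgK isos_conj.
Qed.

End Fusion.

(* A finite category whose objects are the subgroups of S satisfying [obj].
   It is given by its set of arrows; [cid P] is significant only if P is an
   object, and [ccomp g f] (the composite of f followed by g) only if the
   target of f is the source of g. *)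
Record category (S : finGroupType) (obj : pred {group S}) := Category {
  arr :> finType;
  src : arr -> {group S};
  tgt : arr -> {group S};
  cid : {group S} -> arr;
  ccomp : arr -> arr -> arr;
  src_obj : forall g, obj (src g);
  tgt_obj : forall g, obj (tgt g);
  src_id : forall P, obj P -> src (cid P) = P;
  tgt_id : forall P, obj P -> tgt (cid P) = P;
  src_comp : forall g f, tgt f = src g -> src (ccomp g f) = src f;
  tgt_comp : forall g f, tgt f = src g -> tgt (ccomp g f) = tgt g;
  ccompA : forall h g f, tgt f = src g -> tgt g = src h ->
    ccomp h (ccomp g f) = ccomp (ccomp h g) f;
  comp_id : forall f, ccomp f (cid (src f)) = f;
  id_comp : forall f, ccomp (cid (tgt f)) f = f
}.

Definition chom (S : finGroupType) (obj : pred {group S}) (C : category obj)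
    (P Q : {group S}) : {set C} :=
  [set g : C | (src g == P) && (tgt g == Q)].

(* [delta P Q g] is significant only for objects P, Q and g in N_S(P, Q), and
   [lpi g] is the underlying function of a morphism src g -> tgt g of F.  That
   there are finitely many arrows is no restriction: each morphism set is, by
   [linkA_surj] and [linkA_inj], a finite union of orbits of a finite group. *)
Record linking_system (S : finGroupType) (F : fusion_system S) := LinkingSystem {
  lcat :> category (centric F);
  delta : {group S} -> {group S} -> S -> lcat;
  lpi : lcat -> {ffun S -> S};
  delta_hom : forall P Q g, centric F P -> centric F Q ->
    g \in transporter P Q -> delta P Q g \in chom lcat P Q;
  delta_id : forall P, centric F P -> delta P P 1 = cid lcat P;
  delta_comp : forall P Q R g h, centric F P -> centric F Q -> centric F R ->
    g \in transporter P Q -> h \in transporter Q R ->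
    delta P R (h * g) = ccomp (delta Q R h) (delta P Q g);
  lpi_hom : forall P Q g, g \in chom lcat P Q -> lpi g \in F P Q;
  lpi_id : forall P, centric F P -> lpi (cid lcat P) = hincl P;
  lpi_comp : forall g f, tgt f = src g ->
    lpi (ccomp g f) = hcomp (lpi g) (lpi f);
  linkA_free : forall P Q g z, g \in chom lcat P Q -> z \in 'Z(P) ->
    ccomp g (delta P P z) = g -> z = 1;
  linkA_surj : forall P Q f, centric F P -> centric F Q -> f \in F P Q ->
    exists2 g, g \in chom lcat P Q & lpi g = f;
  linkA_inj : forall P Q g h, g \in chom lcat P Q -> h \in chom lcat P Q ->
    (lpi g = lpi h <-> exists2 z, z \in 'Z(P) & h = ccomp g (delta P P z));
  linkB : forall P Q g, centric F P -> centric F Q -> g \in transporter P Q ->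
    lpi (delta P Q g) = hconj P g;
  linkC : forall P Q g x, g \in chom lcat P Q -> x \in P ->
    ccomp g (delta P P x) = ccomp (delta Q Q (lpi g x)) g
}.

Record biset (S : finGroupType) := Biset {
  bset :> finType;
  lact : S -> bset -> bset;
  ract : bset -> S -> bset;
  lact1 : forall w, lact 1 w = w;
  lactM : forall a b w, lact (a * b) w = lact a (lact b w);
  ract1 : forall w, ract w 1 = w;
  ractM : forall w a b, ract w (a * b) = ract (ract w a) b;
  lractA : forall a w b, lact a (ract w b) = ract (lact a w) b;
  lact_free : forall a w, lact a w = w -> a = 1;
  ract_free : forall a w, ract w a = w -> a = 1
}.

Section Bisets.
Variable S : finGroupType.
Implicit Types (W V : biset S) (P Q : {set S}) (f : {ffun S -> S}).

Definition biset_morphism W V (h : W -> V) : Prop :=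
  forall a w b, h (ract (lact a w) b) = ract (lact a (h w)) b.

Definition biset_iso W V : Prop :=
  exists2 h : W -> V, biset_morphism h & bijective h.

(* W is contained in V up to isomorphism. *)
Definition biset_embeds W V : Prop :=
  exists2 h : W -> V, biset_morphism h & injective h.

(* MathComp actions are right actions: this is the right action of S x S
   obtained from the left action (b, a) . w = b w a^-1 through inversion.  The
   two have the same stabilizers, fixed points and orbits. *)
Definition bact_fun W (w : W) (u : S * S) : W := ract (lact u.1^-1 w) u.2.

Lemma bact_fun_is_action W : is_action [set: S * S] (@bact_fun W).
Proof.
apply: is_total_action => [w | w u v]; rewrite /bact_fun /=.
  by rewrite invg1 lact1 ract1.
by rewrite invMg lactM ractM lractA.
Qed.

Canonical bact W := Action (@bact_fun_is_action W).

(* The subgroup (P, f) of S x S. *)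
Definition tdiag P f : {set S * S} := [set (f a, a) | a in P].

Definition nfix W P f : nat := #|'Fix_(bact W)(tdiag P f)|.

(* The orbit of w is isomorphic, as a left (S x S)-set, to (S x S) / D. *)
Definition orbit_iso W (w : W) (D : {set S * S}) : bool :=
  [exists h : {ffun {set S * S} -> W},
    [&& [forall X in lcosets D [set: S * S], forall Y in lcosets D [set: S * S],
           (h X == h Y) ==> (X == Y)],
        h @: lcosets D [set: S * S] == orbit (bact W) [set: S * S] w
      & [forall u : S * S, forall X in lcosets D [set: S * S],
           h (u *: X) == ract (lact u.1 (h X)) u.2^-1]]].

Lemma orbit_iso_act W (w : W) a b D :
  orbit_iso (ract (lact a w) b) D = orbit_iso w D.
Proof.
rewrite /orbit_iso.
suff -> : orbit (bact W) [set: S * S] (ract (lact a w) b)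
        = orbit (bact W) [set: S * S] w by [].
apply/orbit_eqP; apply/orbitP; exists (a^-1, b); rewrite ?inE //=.
by rewrite /bact_fun /= invgK.
Qed.

Lemma sub_biset_proof W (A : pred W) :
    (forall a w b, A (ract (lact a w) b) = A w) ->
  (forall a w, A w -> A (lact a w)) * (forall w b, A w -> A (ract w b)).
Proof.
move=> clA; split=> [a w | w b] Aw.
  by rewrite -[lact a w]ract1 clA.
by rewrite -[w]lact1 clA.
Qed.

Section SubBiset.
Variables (W : biset S) (A : pred W).
Hypothesis clA : forall a w b, A (ract (lact a w) b) = A w.

Let T := {w : W | A w}.
Let slact (a : S) (w : T) : T :=
  exist _ (lact a (val w)) ((sub_biset_proof clA).1 a (val w) (valP w)).
Let sract (w : T) (b : S) : T :=
  exist _ (ract (val w) b) ((sub_biset_proof clA).2 (val w) b (valP w)).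

Definition sub_biset : biset S.
Proof.
apply: (@Biset S T slact sract).
- by move=> w; apply: val_inj; apply: lact1.
- by move=> a b w; apply: val_inj; apply: lactM.
- by move=> w; apply: val_inj; apply: ract1.
- by move=> w a b; apply: val_inj; apply: ractM.
- by move=> a w b; apply: val_inj; apply: lractA.
- by move=> a w /(congr1 val); apply: lact_free.
- by move=> a w /(congr1 val); apply: ract_free.
Defined.

End SubBiset.

End Bisets.

Section Characteristic.
Variables (S : finGroupType) (p : nat) (F : fusion_system S).
Implicit Types (P Q R : {group S}) (f : {ffun S -> S}) (W V : biset S).

Definition fgenerated W : Prop :=
  forall w : W, exists P f,
    f \in F P [set: S]%G /\ 'C[w | bact W] = tdiag P f.

(* R plays the role of f(P). *)
Definition fstable W : Prop :=
  forall P f R (Q T : {group S}) (e1 e2 : {ffun S -> S}),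
    f \in injhom P [set: S]%G -> f @: P = R ->
    e1 \in isos F Q P -> e2 \in isos F R T ->
    nfix W P f = nfix W Q (hcomp e2 (hcomp f e1)).

(* The division is exact, since S acts freely. *)
Definition degree_prime_to_p W : Prop := ~~ (p %| #|W| %/ #|[set: S]|).

Definition fcharacteristic W : Prop :=
  [/\ fgenerated W, fstable W & degree_prime_to_p W].

Definition centric_characteristic W : Prop :=
  [/\ fgenerated W,
      forall w : W, exists P f,
        [/\ centric F P, f \in injhom P [set: S]%G
          & 'C[w | bact W] = tdiag P f],
      forall P f, centric F P -> f \in F P [set: S]%G ->
        nfix W P f = nfix W P (hincl P) /\
        nfix W P (hincl P) = nfix W (f @: P) (hinv P f)
    & degree_prime_to_p W].

(* W is minimal among the bisets with property C. *)
Definition minimal_biset (C : biset S -> Prop) W : Prop :=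
  C W /\ forall V, C V -> biset_embeds W V.

(* The orbit of w is isomorphic to [Q, f] for some Q that is not centric. *)
Definition noncentric_point W (w : W) : bool :=
  [exists Q : {group S}, exists f : {ffun S -> S},
    [&& ~~ centric F Q, f \in injhom Q [set: S]%G & orbit_iso w (tdiag Q f)]].

Lemma noncentric_point_act W a (w : W) b :
  ~~ noncentric_point (ract (lact a w) b) = ~~ noncentric_point w.
Proof.
congr (~~ _); apply: eq_existsb => Q; apply: eq_existsb => f.
by rewrite orbit_iso_act.
Qed.

Definition centric_part W : biset S := sub_biset (@noncentric_point_act W).

End Characteristic.

Section Nonextendable.
Variables (S : finGroupType) (F : fusion_system S) (L : linking_system F).
Implicit Types (P Q R : {group S}) (g h : L) (a b x : S).

Definition is_iso g : bool :=
  [exists h in chom L (tgt g) (src g),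
    (ccomp h g == cid L (src g)) && (ccomp g h == cid L (tgt g))].

Definition extends h g : bool :=
  [&& src g \subset src h, tgt g \subset tgt h &
      ccomp h (delta L (src g) (src h) 1)
        == ccomp (delta L (tgt g) (tgt h) 1) g].

Definition nonextendable g : bool :=
  is_iso g &&
  ~~ [exists h, [&& is_iso h, extends h g & src g \proper src h]].

(* a . g and g . b; composing them gives a . g . b. *)
Definition arr_lact a g : L :=
  ccomp (delta L (tgt g) (tgt g :^ a^-1)%G a) g.

Definition arr_ract g b : L :=
  ccomp g (delta L (src g :^ b)%G (src g) b).

Local Notation del := (delta L).

Lemma tsp1 (A B : {set S}) : A \subset B -> 1 \in transporter A B.
Proof. by rewrite inE invg1 conjsg1. Qed.

Lemma tspS (A B : {set S}) a :
  A \subset B -> a \in transporter A (B :^ a^-1).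
Proof. by rewrite inE conjSg. Qed.

Lemma tspV (A B : {set S}) a : A \subset B -> a \in transporter (A :^ a) B.
Proof. by rewrite inE -conjsgM mulgV conjsg1. Qed.

Lemma del_src P Q a : centric F P -> centric F Q -> a \in transporter P Q ->
  src (del P Q a) = P.
Proof. by move=> cP cQ /(delta_hom L cP cQ); rewrite inE => /andP[/eqP]. Qed.

Lemma del_tgt P Q a : centric F P -> centric F Q -> a \in transporter P Q ->
  tgt (del P Q a) = Q.
Proof. by move=> cP cQ /(delta_hom L cP cQ); rewrite inE => /andP[_ /eqP]. Qed.

Let cs g : centric F (src g) := src_obj g.
Let ct g : centric F (tgt g) := tgt_obj g.
Let cJ P a : centric F P -> centric F (P :^ a)%G := @centricJ S F P a.

Lemma comp_hom P Q R g h : g \in chom L P Q -> h \in chom L Q R ->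
  ccomp h g \in chom L P R.
Proof.
rewrite !inE => /andP[/eqP <- /eqP tg] /andP[/eqP sh /eqP <-].
by rewrite src_comp ?tgt_comp ?eqxx // tg sh.
Qed.

Lemma self_hom g : g \in chom L (src g) (tgt g).
Proof. by rewrite inE !eqxx. Qed.

Lemma is_isoP P Q g : g \in chom L P Q -> 
  reflect (exists h, [/\ h \in chom L Q P, ccomp h g = cid L P
                        & ccomp g h = cid L Q])
          (is_iso g).
Proof.
rewrite inE => /andP[/eqP <- /eqP <-]; apply: (iffP existsP) => -[h].
  by case/and3P=> hh /eqP e1 /eqP e2; exists h.
by case=> hh e1 e2; exists h; rewrite hh e1 e2 !eqxx.
Qed.

Lemma is_iso_comp g h : tgt g = src h -> is_iso g -> is_iso h ->
  is_iso (ccomp h g).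
Proof.
move=> e ig ih.
have hg := self_hom g; have hh := self_hom h; rewrite -e in hh.
have /(is_isoP hg)[g' [hg' a1 a2]] := ig.
have /(is_isoP hh)[h' [hh' b1 b2]] := ih.
apply/(is_isoP (comp_hom hg hh)); exists (ccomp g' h').
have := hg'; rewrite inE => /andP[/eqP sg' /eqP tg'].
have := hh'; rewrite inE => /andP[/eqP sh' /eqP th'].
split; first exact: comp_hom hh' hg'.
  rewrite -ccompA ?(ccompA e) ?b1 ?src_comp ?tgt_comp ?sh' ?th' //.
  by rewrite id_comp a1.
rewrite -ccompA ?src_comp ?tgt_comp ?th' //.
rewrite (@ccompA _ _ _ g g' h') ?th' // a2.
by rewrite -th' id_comp b2.
Qed.

Lemma is_iso_delta P a : centric F P -> is_iso (del P (P :^ a^-1)%G a).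
Proof.
move=> cP; have cQ : centric F (P :^ a^-1)%G by apply: cJ.
have tQ : a^-1 \in transporter (P :^ a^-1)%G P by rewrite tspV.
have tP : a \in transporter P (P :^ a^-1)%G by rewrite tspS.
apply/(is_isoP (delta_hom L cP cQ tP)); exists (del (P :^ a^-1)%G P a^-1).
by split; rewrite ?delta_hom -?delta_comp ?mulVg ?mulgV ?delta_id.
Qed.

Lemma is_iso_deltaV P b : centric F P -> is_iso (del (P :^ b)%G P b).
Proof.
move=> cP; have := @is_iso_delta (P :^ b)%G b (cJ b cP).
by congr (is_iso (del _ _ b)); apply: val_inj; rewrite /= conjsgK.
Qed.

Lemma src_arr_lact a g : src (arr_lact a g) = src g.
Proof. by rewrite /arr_lact src_comp ?del_src ?tspS ?cJ. Qed.

Lemma tgt_arr_lact a g : tgt (arr_lact a g) = (tgt g :^ a^-1)%G.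
Proof. by rewrite /arr_lact tgt_comp ?del_src ?del_tgt ?tspS ?cJ. Qed.

Lemma src_arr_ract g b : src (arr_ract g b) = (src g :^ b)%G.
Proof. by rewrite /arr_ract src_comp ?del_src ?del_tgt ?tspV ?cJ. Qed.

Lemma tgt_arr_ract g b : tgt (arr_ract g b) = tgt g.
Proof. by rewrite /arr_ract tgt_comp ?del_tgt ?tspV ?cJ. Qed.

Lemma arr_lact1 g : arr_lact 1 g = g.
Proof.
rewrite /arr_lact.
have -> : (tgt g :^ 1^-1)%G = tgt g by apply: val_inj; rewrite /= invg1 conjsg1.
by rewrite delta_id // id_comp.
Qed.

Lemma arr_ract1 g : arr_ract g 1 = g.
Proof.
rewrite /arr_ract.
have -> : (src g :^ 1)%G = src g by apply: val_inj; rewrite /= conjsg1.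
by rewrite delta_id // comp_id.
Qed.

Lemma arr_lactM a b g : arr_lact (a * b) g = arr_lact a (arr_lact b g).
Proof.
rewrite {2}/arr_lact tgt_arr_lact /arr_lact.
have -> : (tgt g :^ (a * b)^-1)%G = ((tgt g :^ b^-1) :^ a^-1)%G.
  by apply: val_inj; rewrite /= invMg conjsgM.
rewrite (@delta_comp _ _ L _ (tgt g :^ b^-1)%G) ?tspS ?cJ //.
by rewrite -ccompA ?del_src ?del_tgt ?tspS ?cJ.
Qed.

Lemma arr_ractM g a b : arr_ract g (a * b) = arr_ract (arr_ract g a) b.
Proof.
rewrite {2}/arr_ract src_arr_ract /arr_ract.
have -> : (src g :^ (a * b))%G = ((src g :^ a) :^ b)%G.
  by apply: val_inj; rewrite /= conjsgM.
rewrite (@delta_comp _ _ L _ (src g :^ a)%G) ?tspV ?cJ //.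
by rewrite ccompA ?del_src ?del_tgt ?tspV ?cJ.
Qed.

Lemma arr_lractA a g b : arr_lact a (arr_ract g b) = arr_ract (arr_lact a g) b.
Proof.
rewrite /arr_lact tgt_arr_ract /arr_ract src_arr_lact.
by rewrite ccompA ?del_src ?del_tgt ?tspV ?tspS ?cJ.
Qed.

Lemma extends_lact a h g : extends h g -> extends (arr_lact a h) (arr_lact a g).
Proof.
case/and3P=> sP sQ /eqP e.
rewrite /extends !src_arr_lact !tgt_arr_lact sP conjSg sQ /=.
rewrite /arr_lact -ccompA ?del_src ?del_tgt ?tspS ?tsp1 ?cJ // e.
rewrite !ccompA ?del_src ?del_tgt ?tspS ?tsp1 ?conjSg ?cJ //.
by rewrite -!delta_comp ?mul1g ?mulg1 ?tspS ?tsp1 ?conjSg ?cJ.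
Qed.

Lemma extends_ract h g b : extends h g -> extends (arr_ract h b) (arr_ract g b).
Proof.
case/and3P=> sP sQ /eqP e.
rewrite /extends !src_arr_ract !tgt_arr_ract sQ conjSg sP /=.
rewrite /arr_ract (@ccompA _ _ _ _ g) ?del_src ?del_tgt ?tspV ?tsp1 ?cJ // -e.
rewrite -!ccompA ?del_src ?del_tgt ?tspV ?tsp1 ?conjSg ?cJ //.
by rewrite -!delta_comp ?mul1g ?mulg1 ?tspV ?tsp1 ?conjSg ?cJ.
Qed.

Lemma is_iso_lact a g : is_iso g -> is_iso (arr_lact a g).
Proof.
move=> ig; rewrite /arr_lact is_iso_comp ?is_iso_delta //.
by rewrite del_src ?tspS ?cJ.
Qed.

Lemma is_iso_ract g b : is_iso g -> is_iso (arr_ract g b).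
Proof.
move=> ig; rewrite /arr_ract is_iso_comp ?is_iso_deltaV //.
by rewrite del_tgt ?tspV ?cJ.
Qed.

Lemma nonextendable_lact a g : nonextendable g -> nonextendable (arr_lact a g).
Proof.
case/andP=> ig /existsP nx; rewrite /nonextendable is_iso_lact //=.
apply/existsP=> -[h /and3P[ih xh ph]]; apply: nx; exists (arr_lact a^-1 h).
rewrite is_iso_lact //= src_arr_lact; rewrite src_arr_lact in ph; rewrite ph.
by have := extends_lact a^-1 xh; rewrite -arr_lactM mulVg arr_lact1 => ->.
Qed.

Lemma nonextendable_ract g b : nonextendable g -> nonextendable (arr_ract g b).
Proof.
case/andP=> ig /existsP nx; rewrite /nonextendable is_iso_ract //=.
apply/existsP=> -[h /and3P[ih xh ph]]; apply: nx; exists (arr_ract h b^-1).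
rewrite is_iso_ract //=; rewrite src_arr_ract in ph.
have := extends_ract b^-1 xh; rewrite -arr_ractM mulgV arr_ract1 => -> /=.
move: ph; rewrite src_arr_ract /= -(properJ _ _ b^-1).
by rewrite -conjsgM mulgV conjsg1.
Qed.

Lemma delta_inj P a b : centric F P -> a \in 'N(P) -> b \in 'N(P) ->
  del P P a = del P P b -> a = b.
Proof.
move=> cP Na Nb e.
have tN c : c \in 'N(P) -> c \in transporter P P.
  by move=> Nc; rewrite inE (normP _) ?groupV.
have NV : b^-1 \in 'N(P) by rewrite groupV.
have e1 : del P P (b^-1 * a) = cid L P.
  by rewrite (@delta_comp _ _ L _ P) ?tN // e -delta_comp ?tN // mulVg delta_id.
have Nba := groupM NV Na.
have Zba : b^-1 * a \in 'Z(P).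
  have Cba : b^-1 * a \in 'C(P).
    have := congr1 (@lpi _ _ L) e1; rewrite linkB ?tN // lpi_id // => /ffunP E.
    rewrite -groupV; apply/centP=> x Px; apply/commute_sym/commgP/conjg_fixP.
    by have := E x; rewrite !ffunE Px.
  rewrite inE Cba andbT; move/forallP/(_ P)/implyP: (cP) => /(_ _)/subsetP.
  apply=> //; apply/existsP; exists (hincl P).
  have -> : hincl P = hconj P 1.
    by apply/ffunP=> x; rewrite !ffunE invg1 conjg1.
  have := @isos_conj S F P 1.
  by congr (_ \in isos F P _); apply: val_inj; rewrite /= invg1 conjsg1.
have hid : cid L P \in chom L P P by rewrite inE src_id ?tgt_id ?eqxx.
have := @linkA_free _ _ L P P (cid L P) _ hid Zba.
rewrite e1 -{2}(src_id L cP) comp_id => /(_ erefl) /(congr1 (fun c => b * c)).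
by rewrite mulKVg mulg1.
Qed.

Lemma arr_lact_free a g : is_iso g -> arr_lact a g = g -> a = 1.
Proof.
move=> /(is_isoP (self_hom g))[h [hh e1 e2]] ag.
move: hh; rewrite inE => /andP[/eqP sh /eqP th].
have eQ : (tgt g :^ a^-1)%G = tgt g by rewrite -tgt_arr_lact ag.
have Na : a \in 'N(tgt g).
  by rewrite -groupV; apply/normP; exact: (congr1 val eQ).
apply: (@delta_inj (tgt g)); rewrite ?group1 //.
have := congr1 (fun f => ccomp f h) ag; rewrite /arr_lact eQ.
rewrite -ccompA ?th ?del_src ?inE ?(normP _) ?groupV // e2 delta_id // => <-.
rewrite -[in X in _ = ccomp _ (cid _ X)](@del_src (tgt g) (tgt g) a) ?comp_id //.
by rewrite inE (normP _) ?groupV.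
Qed.

Lemma arr_ract_free g b : is_iso g -> arr_ract g b = g -> b = 1.
Proof.
move=> /(is_isoP (self_hom g))[h [hh e1 e2]] gb.
move: hh; rewrite inE => /andP[/eqP sh /eqP th].
have eP : (src g :^ b)%G = src g by rewrite -src_arr_ract gb.
have Nb : b \in 'N(src g) by apply/normP; exact: (congr1 val eP).
have tb : b \in transporter (src g) (src g) by rewrite inE (normP _) ?groupV.
apply: (@delta_inj (src g)); rewrite ?group1 //.
have := congr1 (fun f => ccomp h f) gb; rewrite /arr_ract eP.
rewrite ccompA ?sh ?del_tgt // e1 delta_id // => <-.
by rewrite -[in X in _ = ccomp (cid _ X) _](@del_tgt (src g) (src g) b) ?id_comp.
Qed.

Let T := {g : L | nonextendable g}.
Let nlact (a : S) (g : T) : T :=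
  exist _ (arr_lact a (val g)) (nonextendable_lact a (valP g)).
Let nract (g : T) (b : S) : T :=
  exist _ (arr_ract (val g) b) (nonextendable_ract b (valP g)).

Definition nonext_biset : biset S.
Proof.
apply: (@Biset S T nlact nract).
- by move=> g; apply: val_inj; apply: arr_lact1.
- by move=> a b g; apply: val_inj; apply: arr_lactM.
- by move=> g; apply: val_inj; apply: arr_ract1.
- by move=> g a b; apply: val_inj; apply: arr_ractM.
- by move=> a g b; apply: val_inj; apply: arr_lractA.
- move=> a g /(congr1 val); apply: arr_lact_free.
  by case/andP: (valP g).
- move=> b g /(congr1 val); apply: arr_ract_free.
  by case/andP: (valP g).
Defined.

End Nonextendable.

(* Main.v *)
(* An isomorphism g of L is nonextendable iff pi(g) =: psi is nonextendable in F,
   and then N_psi = P for its source P.  Morphisms of L are determined by their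
   restrictions, and each morphism from a centric P to S has a unique maximal
   extension; hence the points of I fixed by (P, phi) correspond to the lifts
   of phi to L(P, S), of which there are |Z(P)|, independently of phi.  The degree
   is |Out_F(S)| modulo p.
   Conversely let V be a centric characteristic biset.  Its degree provides a point
   with stabilizer (S, phi), and then stability provides points fixed by (P, psi)
   for all centric P.  If N_psi = P, such a point has stabilizer exactly (P, psi),
   and since each orbit type occurs at most once in I, this embeds I in V.
   For the last part, noncentric orbits are added to I by descending order of the
   group until it is stable; this needs the congruence of the numbers of fixed
   points of (Q, psi) and (P, incl), P fully normalized, modulo |N(Q, psi) : Q|.
   The minimal characteristic biset embeds in the result, so that its centric part
   has at most |I| points. *)

Require Import Defs.
From HB Require Import structures.
From mathcomp Require Import all_boot all_fingroup all_solvable.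

Set Implicit Arguments.
Unset Strict Implicit.
Unset Printing Implicit Defensive.

Import GroupScope.
(* all_solvable has its own [is_iso]. *)
Import Defs.

(** * Fusion systems *)

(** Centricity enters in three ways. A centric subgroup is fully centralized, so the extension axiom
    applies to every morphism out of it. An element of C(P) that arises when two morphisms of [L]
    are compared lies in Z(P), which acts freely by axiom (A). Overgroups of centric subgroups are
    centric, so noncentric orbits contribute no points fixed by a centric (P, phi), and completing a
    biset by such orbits leaves the counts for centric subgroups untouched. Adding orbits can only
    raise a number of fixed points. The completion therefore aims, on each isomorphism class, at a
    common value no smaller than any present count. The congruence makes each deficit a multiple of
    |N(Q, psi) : Q|, which is the number of points of [Q, psi] fixed by (Q, psi); copies of this one
    biset fill it. Each isomorphism of bisets is obtained from an embedding and a comparison of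
    cardinalities. *)

Definition hrestr (S : finGroupType) (P : {set S}) (f : {ffun S -> S}) :
  {ffun S -> S} := [ffun x => if x \in P then f x else 1].

Section InjectiveHomomorphisms.
Variable S : finGroupType.
Implicit Types (P Q R : {group S}) (f g : {ffun S -> S}) (x y : S).

Lemma injhomP P Q f : reflect
  [/\ {in P &, {morph f : x y / x * y}}, {in P &, injective f},
      f @: P \subset Q & forall x, x \notin P -> f x = 1]
  (f \in injhom P Q).
Proof.
rewrite inE; apply: (iffP and4P) => -[fM fI fP f1]; split=> //.
- move=> x y Px Py; apply/eqP.
  by move/forall_inP/(_ x Px)/forall_inP/(_ y Py): fM.
- move=> x y Px Py /eqP.
  by move/forall_inP/(_ x Px)/forall_inP/(_ y Py)/implyP: fI => h /h/eqP.
- by move=> x; move/forallP/(_ x)/implyP: f1 => h /h/eqP.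
- by apply/forall_inP=> x Px; apply/forall_inP=> y Py; rewrite fM.
- apply/forall_inP=> x Px; apply/forall_inP=> y Py.
  by apply/implyP=> /eqP/fI->.
- by apply/forallP=> x; apply/implyP=> /f1/eqP.
Qed.

Section OneHom.
Variables (P Q : {group S}) (f : {ffun S -> S}).
Hypothesis fPQ : f \in injhom P Q.

Lemma injhomM : {in P &, {morph f : x y / x * y}}.
Proof. by case/injhomP: fPQ. Qed.

Lemma injhom_inj : {in P &, injective f}.
Proof. by case/injhomP: fPQ. Qed.

Lemma injhomV : {in P, {morph f : x / x^-1}}.
Proof.
move=> x Px; apply: (mulgI (f x)).
by rewrite -injhomM ?groupV // !mulgV (injhom1 fPQ).
Qed.

Lemma injhomJ : {in P &, {morph f : x y / x ^ y}}.
Proof. by move=> x y Px Py; rewrite !conjgE !injhomM ?injhomV ?groupM ?groupV. Qed.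

Lemma injhom_eq1 x : x \in P -> (f x == 1) = (x == 1).
Proof.
move=> Px; apply/eqP/eqP=> [e|->]; last exact: (injhom1 fPQ).
by apply: injhom_inj; rewrite ?group1 ?(injhom1 fPQ).
Qed.

Lemma card_injhom : #|f @: P| = #|P|.
Proof. exact: card_in_imset injhom_inj. Qed.

Lemma hrestr_injhom R : R \subset P -> hrestr R f \in injhom R Q.
Proof.
move=> /subsetP RP; apply/injhomP; split.
- by move=> x y Rx Ry; rewrite !ffunE Rx Ry groupM // injhomM ?RP.
- by move=> x y Rx Ry; rewrite !ffunE Rx Ry => /injhom_inj->; rewrite ?RP.
- apply/subsetP=> _ /imsetP[x Rx ->]; rewrite ffunE Rx.
  exact: injhom_sub fPQ (RP _ Rx).
- by move=> x /negbTE nRx; rewrite ffunE nRx.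
Qed.

Lemma hrestr_hcomp R : R \subset P -> hcomp f (hincl R) = hrestr R f.
Proof.
move=> /subsetP RP; apply/ffunP=> x; rewrite !ffunE; case: ifP => // _.
exact: injhom1 fPQ.
Qed.

Lemma hrestr_id : hrestr P f = f.
Proof.
apply/ffunP=> x; rewrite ffunE; case: ifPn => // nPx.
by rewrite (injhom_out fPQ nPx).
Qed.

End OneHom.

Lemma injhom_eq P Q Q' f g : f \in injhom P Q -> g \in injhom P Q' ->
  {in P, f =1 g} -> f = g.
Proof.
move=> hf hg e; apply/ffunP=> x; case: (boolP (x \in P)) => [/e//|nPx].
by rewrite (injhom_out hf nPx) (injhom_out hg nPx).
Qed.

Lemma hconj1 (P : {set S}) : hconj P 1 = hincl P.
Proof. by apply/ffunP=> x; rewrite !ffunE invg1 conjg1. Qed.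

Lemma tdiagP (P : {set S}) f u :
  reflect (u.2 \in P /\ u.1 = f u.2) (u \in tdiag P f).
Proof.
apply: (iffP imsetP) => [[a Pa ->]|[Pu e]] //.
by exists u.2; rewrite // -e -surjective_pairing.
Qed.

Lemma mem_tdiag (P : {set S}) f a b : 
  ((b, a) \in tdiag P f) = (a \in P) && (b == f a).
Proof. by apply/tdiagP/andP => -[/= Pa /eqP]; split=> //; apply/eqP. Qed.

Lemma card_tdiag (P : {set S}) f : #|tdiag P f| = #|P|.
Proof. by apply: card_in_imset => x y _ _ []. Qed.

(** Stabilizers are graphs, so a point with stabilizer (Q, g) is fixed by (P, f) exactly when g
    extends f. Questions on fixed points become questions on restrictions. *)
Lemma tdiag_sub P Q R R' f g : f \in injhom P R -> g \in injhom Q R' ->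
  (tdiag P f \subset tdiag Q g) = (P \subset Q) && (hrestr P g == f).
Proof.
move=> hf hg; apply/subsetP/andP=> [h|[/subsetP PQ /eqP<-]].
  have hP a : a \in P -> a \in Q /\ f a = g a.
    move=> Pa; have := h (f a, a); rewrite !mem_tdiag Pa eqxx => /(_ isT).
    by case/andP=> ? /eqP.
  have PQ : P \subset Q by apply/subsetP=> a /hP[].
  split=> //; apply/eqP; apply: injhom_eq (hrestr_injhom hg PQ) hf _.
  by move=> a Pa; rewrite ffunE Pa; case: (hP a Pa).
move=> u /tdiagP[Pu e]; apply/tdiagP; split; first exact: PQ.
by rewrite e ffunE Pu.
Qed.

Lemma tdiag_inj P Q R R' f g : f \in injhom P R -> g \in injhom Q R' ->
  tdiag P f = tdiag Q g -> P = Q /\ f = g.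
Proof.
move=> hf hg e.
have := tdiag_sub hf hg; rewrite e subxx => /esym/andP[PQ /eqP fg].
have := tdiag_sub hg hf; rewrite e subxx => /esym/andP[QP _].
have ePQ : P = Q by apply: val_inj; apply/eqP; rewrite eqEsubset PQ QP.
by split=> //; rewrite -fg ePQ (hrestr_id hg).
Qed.

Lemma tdiag_group_set P Q f : f \in injhom P Q -> group_set (tdiag P f).
Proof.
move=> hf; apply/group_setP; split.
  by rewrite mem_tdiag group1 (injhom1 hf) eqxx.
move=> u v /tdiagP[Pu eu] /tdiagP[Pv ev]; apply/tdiagP; rewrite /= groupM //.
by rewrite eu ev (injhomM hf).
Qed.

End InjectiveHomomorphisms.

(** * Isomorphisms, centric subgroups and extensions in a fusion system *)

Section FusionTheory.
Variables (S : finGroupType) (F : fusion_system S).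
Implicit Types (P Q R A B : {group S}) (f g : {ffun S -> S}) (x y : S).
Local Notation SG := [set: S]%G.

Lemma fhom_injhom P Q f : f \in F P Q -> f \in injhom P Q.
Proof. exact: (subsetP (fhom_inj F P Q)). Qed.

Lemma fhom_incl P Q : P \subset Q -> hincl P \in F P Q.
Proof. by move=> PQ; rewrite -hconj1 fhom_conj ?tsp1. Qed.

Lemma fhom_restr P Q R f : R \subset P -> f \in F P Q -> hrestr R f \in F R Q.
Proof.
move=> RP hf; rewrite -(hrestr_hcomp (fhom_injhom hf) RP).
exact: fhom_comp (fhom_incl RP) hf.
Qed.

Lemma isosP P Q f : reflect
  (exists g, [/\ f \in F P Q, g \in F Q P, {in P, cancel f g} & {in Q, cancel g f}])
  (f \in isos F P Q).
Proof.
rewrite inE; apply: (iffP andP) => [[hf /existsP[g /and3P[hg /eqP e1 /eqP e2]]]|].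
  exists g; split=> // x hx.
    by move/ffunP/(_ x): e1; rewrite !ffunE hx.
  by move/ffunP/(_ x): e2; rewrite !ffunE hx.
case=> g [hf hg e1 e2]; split=> //; apply/existsP; exists g; rewrite hg /=.
have h1 := fhom_incl (subxx P); have h2 := fhom_incl (subxx Q).
apply/andP; split; apply/eqP.
  apply: (injhom_eq (fhom_injhom (fhom_comp hf hg)) (fhom_injhom h1)).
  by move=> x Px; rewrite !ffunE Px e1.
apply: (injhom_eq (fhom_injhom (fhom_comp hg hf)) (fhom_injhom h2)).
by move=> x Px; rewrite !ffunE Px e2.
Qed.

Lemma isos_fhom P Q f : f \in isos F P Q -> f \in F P Q.
Proof. by rewrite inE => /andP[]. Qed.

Lemma isos_injhom P Q f : f \in isos F P Q -> f \in injhom P Q.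
Proof. by move/isos_fhom/fhom_injhom. Qed.

Lemma isos_im P Q f : f \in isos F P Q -> f @: P = Q.
Proof.
case/isosP=> g [hf hg e1 e2]; apply/eqP; rewrite eqEsubset.
case/injhomP: (fhom_injhom hf) => _ _ -> _ /=; apply/subsetP=> x Qx.
by rewrite -(e2 x Qx) imset_f // (injhom_sub (fhom_injhom hg) Qx).
Qed.

Lemma isos_inv P Q f : f \in isos F P Q ->
  exists g, [/\ g \in isos F Q P, {in P, cancel f g} & {in Q, cancel g f}].
Proof.
by case/isosP=> g [hf hg e1 e2]; exists g; split=> //; apply/isosP; exists f.
Qed.

Lemma isos_incl P : hincl P \in isos F P P.
Proof.
have h := fhom_incl (subxx P); apply/isosP; exists (hincl P).
by split=> // x Px; rewrite !ffunE Px /= Px.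
Qed.

Lemma fhom_isos P Q R f : f \in F P Q -> f @: P = R -> f \in isos F P R.
Proof.
move=> /fhom_factor[R' _ hf] e; suff -> : R = R' by [].
by apply: val_inj; rewrite /= -e (isos_im hf).
Qed.

Lemma fhom_im P Q f : f \in F P Q ->
  exists R, [/\ f @: P = R, R \subset Q & f \in isos F P R].
Proof. by case/fhom_factor=> R RQ hf; exists R; rewrite (isos_im hf). Qed.

Lemma fhom_codom P Q R f : f \in F P Q -> f @: P \subset R -> f \in F P R.
Proof.
move=> /fhom_im[T [eT _ /isos_fhom hf]]; rewrite eT => TR.
have h := fhom_comp hf (fhom_incl TR).
rewrite -[f](_ : hcomp (hincl T) f = f) //.
apply: injhom_eq (fhom_injhom h) (fhom_injhom hf) _ => x Px.
by rewrite !ffunE (injhom_sub (fhom_injhom hf) Px).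
Qed.

Lemma fhom_codomT P Q f : f \in F P Q -> f \in F P SG.
Proof. by move=> hf; apply: fhom_codom hf (subsetT _). Qed.

Lemma isos_hinv P Q f : f \in isos F P Q ->
  [/\ hinv P f \in isos F Q P, {in P, cancel f (hinv P f)}
    & {in Q, cancel (hinv P f) f}].
Proof.
move=> hf; have [g [hg e1 e2]] := isos_inv hf.
suff -> : hinv P f = g by [].
apply/ffunP=> y; rewrite ffunE; case: pickP => [x /andP[Px /eqP<-]|h] /=.
  by rewrite e1.
case: (boolP (y \in Q)) => [Qy|nQy]; last by rewrite (injhom_out (isos_injhom hg)).
by have := h (g y); rewrite (injhom_sub (isos_injhom hg) Qy) (e2 _ Qy) eqxx.
Qed.

Lemma fiso_refl P : fisomorphic F P P.
Proof. by apply/existsP; exists (hincl P); apply: isos_incl. Qed.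

Lemma fiso_isos P Q f : f \in isos F P Q -> fisomorphic F P Q.
Proof. by move=> hf; apply/existsP; exists f. Qed.

Lemma fiso_sym P Q : fisomorphic F P Q = fisomorphic F Q P.
Proof.
by apply/idP/idP=> /existsP[f /isos_inv[g [/fiso_isos]]].
Qed.

Lemma fiso_trans Q P R :
  fisomorphic F P Q -> fisomorphic F Q R -> fisomorphic F P R.
Proof.
case/existsP=> f hf /existsP[g hg]; apply/existsP; exists (hcomp g f).
exact: isos_comp hf hg.
Qed.

Lemma fisoJ P x : fisomorphic F P (P :^ x)%G.
Proof. by apply/existsP; exists (hconj P x^-1); rewrite -{2}[x]invgK isos_conj. Qed.

Lemma fiso_card P Q : fisomorphic F P Q -> #|P| = #|Q|.
Proof.
by case/existsP=> f hf; rewrite -(isos_im hf) (card_injhom (isos_injhom hf)).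
Qed.

Lemma centric_fiso P Q : fisomorphic F P Q -> centric F P -> centric F Q.
Proof.
move=> PQ /forallP cP; apply/forallP=> R; apply/implyP=> QR.
exact: implyP (cP R) (fiso_trans PQ QR).
Qed.

Lemma centric_cent P : centric F P -> 'C(P) \subset P.
Proof. by move/forallP/(_ P)/implyP; apply; apply: fiso_refl. Qed.

(** A subgroup Q isomorphic to R contains an isomorphic copy T of P, and C(Q) <= C(T) <= T <= Q. *)
Lemma centric_over P R : centric F P -> P \subset R -> centric F R.
Proof.
move=> cP PR; apply/forallP=> Q; apply/implyP=> /existsP[f hf].
have hr := fhom_restr PR (isos_fhom hf).
have [T [_ TQ /fiso_isos PT]] := fhom_im hr.
have cT := centric_cent (centric_fiso PT cP).
exact: subset_trans (centS TQ) (subset_trans cT TQ).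
Qed.

Lemma centricT : centric F SG.
Proof.
apply/forallP=> Q; apply/implyP=> /fiso_card e.
suff -> : Q :=: [set: S] by apply: subsetT.
by apply/eqP; rewrite eqEcard subsetT /= -e.
Qed.

Lemma isos_center P Q f x : f \in isos F P Q -> x \in P ->
  (f x \in 'Z(Q)) = (x \in 'Z(P)).
Proof.
move=> hf Px; have h := isos_injhom hf.
rewrite !inE Px (injhom_sub h Px) /=; apply/centP/centP=> c y hy.
  apply: (injhom_inj h); rewrite ?groupM // !(injhomM h) //.
  by apply: c; rewrite (injhom_sub h).
move: hy; rewrite -(isos_im hf) => /imsetP[z Pz ->].
by rewrite /commute -!(injhomM h) // c.
Qed.

Lemma fiso_card_center P Q : fisomorphic F P Q -> #|'Z(P)| = #|'Z(Q)|.
Proof.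
case/existsP=> f hf; have h := isos_injhom hf.
have ZP := subsetP (center_sub P).
rewrite -(@card_in_imset _ _ f 'Z(P)); last first.
  by move=> x y /ZP Px /ZP Py; apply: (injhom_inj h).
apply: eq_card => y; apply/imsetP/idP=> [[x Zx ->]|Zy].
  by rewrite (isos_center hf) ?ZP.
have := subsetP (center_sub Q) y Zy; rewrite -(isos_im hf) => /imsetP[x Px e].
by exists x; rewrite // -(isos_center hf Px) -e.
Qed.

Lemma centric_center P : centric F P -> 'C(P) = 'Z(P).
Proof. by move/centric_cent=> h; apply/esym/setIidPr. Qed.

(** On the isomorphism class of P every centralizer is a center, and isomorphic groups have centers
    of the same order. *)
Lemma centric_fully_centralized P : centric F P -> fully_centralized F P.
Proof.
move=> cP; apply/forallP=> Q; apply/implyP=> PQ.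
by rewrite !centric_center ?(centric_fiso PQ) // (fiso_card_center PQ).
Qed.

(** For x in N_R(P), conjugation by g(x) on f(P) is f c_x f^-1. So N_f bounds, one normalizer at a
    time, how far f can be extended. *)
Lemma sub_Nphi P R f g : P \subset R -> f \in F P SG -> g \in F R SG ->
  hrestr P g = f -> 'N_R(P) \subset Nphi P f.
Proof.
move=> PR hf hg e; apply/subsetP=> x /setIP[Rx Nx]; rewrite in_Nphi Nx /=.
have gJ := injhomJ (fhom_injhom hg); have PRs := subsetP PR.
have fE y : y \in P -> f y = g y by move=> Py; rewrite -e ffunE Py.
apply/existsP; exists (g x); apply/andP; split; last first.
  apply/forall_inP=> y Py; have Pyx : y ^ x^-1 \in P by rewrite memJ_norm ?groupV.
  rewrite !fE // -(injhomV (fhom_injhom hg)) // gJ ?groupV //; exact: PRs.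
rewrite inE; apply/subsetP=> _ /imsetP[_ /imsetP[y Py ->] ->].
rewrite fE // -gJ //; last exact: PRs.
rewrite -fE ?memJ_norm //.
by rewrite imset_f // memJ_norm.
Qed.

Variable p : nat.
Hypotheses (pS : p.-group [set: S]) (satF : saturated F p).

Lemma pgroup_norm_eq P R : P \subset R -> 'N_R(P) \subset P -> P = R.
Proof.
move=> PR NP; apply/eqP; apply: contraTT NP => ne.
have pR : p.-group R by apply: pgroupS pS; apply: subsetT.
have := nilpotent_proper_norm (pgroup_nil pR).
rewrite /proper => /(_ P); rewrite PR /=.
case: (boolP (R \subset P)) => RP.
  by case/eqP: ne; apply: val_inj; apply/eqP; rewrite eqEsubset PR RP.
by move=> /(_ isT)/andP[_].
Qed.

Lemma centric_extension P f : centric F P -> f \in F P SG ->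
  exists2 h, h \in F (Nphi_group P f) SG & hrestr P h = f.
Proof.
move=> cP hf; have [Q [eQ _ isof]] := fhom_im hf.
have fcQ : fully_centralized F Q.
  by apply: centric_fully_centralized; apply: centric_fiso cP; apply: fiso_isos isof.
have [h hh e] := satF.2 P Q f hf eQ fcQ; exists h => //.
apply/ffunP=> x; rewrite ffunE; case: ifPn => [/e//|nPx].
by rewrite (injhom_out (fhom_injhom hf)).
Qed.

End FusionTheory.

(** * Linking systems *)

Section LinkingTheory.
Variables (S : finGroupType) (F : fusion_system S) (L : linking_system F).
Implicit Types (P Q R : {group S}) (f : {ffun S -> S}) (g h m : L) (x y z : S).
Local Notation SG := [set: S]%G.
Local Notation del := (delta L).
Let cs g : centric F (src g) := src_obj g.
Let ct g : centric F (tgt g) := tgt_obj g.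

Lemma chomP P Q g : reflect (src g = P /\ tgt g = Q) (g \in chom L P Q).
Proof. by rewrite inE; apply: (iffP andP) => -[/eqP-> /eqP->]. Qed.

Lemma lpi_fhom g : lpi g \in F (src g) (tgt g).
Proof. exact: lpi_hom (self_hom g). Qed.

Lemma lpi_injhom g : lpi g \in injhom (src g) (tgt g).
Proof. exact: fhom_injhom (lpi_fhom g). Qed.

Lemma tspN (A : {set S}) x : x \in 'N(A) -> x \in transporter A A.
Proof. by move=> Nx; rewrite inE (normP _) ?groupV. Qed.

Lemma tsp_mem P x : x \in P -> x \in transporter P P.
Proof. by move=> Px; rewrite tspN // (subsetP (normG P)). Qed.

Lemma lpi_eqP g h : src g = src h -> tgt g = tgt h -> lpi g = lpi h ->
  exists2 z, z \in 'Z(src g) & h = ccomp g (del (src g) (src g) z).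
Proof.
move=> es et; apply: (linkA_inj (self_hom g) _).1.
by rewrite es et self_hom.
Qed.

Lemma delta_ract_free g z : z \in 'Z(src g) ->
  ccomp g (del (src g) (src g) z) = g -> z = 1.
Proof. exact: linkA_free (self_hom g). Qed.

Lemma ccomp_delta g x : x \in src g ->
  ccomp g (del (src g) (src g) x) = ccomp (del (tgt g) (tgt g) (lpi g x)) g.
Proof. exact: linkC (self_hom g). Qed.

Section ObjectActions.
Variable g : L.

Lemma src_delta_tgt y : y \in tgt g -> src (del (tgt g) (tgt g) y) = tgt g.
Proof. by move=> Qy; apply: (del_src L (ct g) (ct g) (tsp_mem Qy)). Qed.

Lemma tgt_delta_tgt y : y \in tgt g -> tgt (del (tgt g) (tgt g) y) = tgt g.
Proof. by move=> Qy; apply: (del_tgt L (ct g) (ct g) (tsp_mem Qy)). Qed.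

Lemma tgt_delta_src x : x \in src g -> tgt (del (src g) (src g) x) = src g.
Proof. by move=> Px; apply: (del_tgt L (cs g) (cs g) (tsp_mem Px)). Qed.

Lemma delta_lact1 : ccomp (del (tgt g) (tgt g) 1) g = g.
Proof. by rewrite (delta_id L (ct g)) id_comp. Qed.

Lemma delta_ract1 : ccomp g (del (src g) (src g) 1) = g.
Proof. by rewrite (delta_id L (cs g)) comp_id. Qed.

Lemma delta_lactM y y' : y \in tgt g -> y' \in tgt g ->
  ccomp (del (tgt g) (tgt g) (y * y')) g =
  ccomp (del (tgt g) (tgt g) y) (ccomp (del (tgt g) (tgt g) y') g).
Proof.
move=> Qy Qy'.
rewrite (delta_comp L (ct g) (ct g) (ct g) (tsp_mem Qy') (tsp_mem Qy)).
by rewrite -ccompA ?tgt_delta_tgt ?src_delta_tgt.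
Qed.

(** Applying [lpi] shows that y centralizes the image of g, which is centric; so y is the image of a
    central x. Axiom (C) moves it to the right of g, where axiom (A) gives x = 1. *)
Lemma delta_lact_free y : y \in tgt g ->
  ccomp (del (tgt g) (tgt g) y) g = g -> y = 1.
Proof.
move=> Qy e; have ig := lpi_injhom g.
have yC : y \in 'C(lpi g @: src g).
  have := congr1 (@lpi _ _ L) e; rewrite lpi_comp ?src_delta_tgt //.
  rewrite (linkB L (ct g) (ct g) (tsp_mem Qy)) => /ffunP E.
  rewrite -groupV; apply/centP=> _ /imsetP[x Px ->].
  apply/commute_sym/commgP/conjg_fixP.
  by have := E x; rewrite !ffunE (injhom_sub ig Px).
have [R [eR _ iso]] := fhom_im (lpi_fhom g).
have cR := centric_fiso (fiso_isos iso) (cs g).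
rewrite eR (centric_center cR) in yC.
have Ry := subsetP (center_sub R) y yC.
move: (Ry); rewrite -eR => /imsetP[x Px ex].
have Zx : x \in 'Z(src g) by rewrite -(isos_center iso Px) -ex.
move: e; rewrite ex -ccomp_delta // => /(delta_ract_free Zx) ->.
by rewrite (injhom1 ig).
Qed.

Lemma delta_lact_inj y y' : y \in tgt g -> y' \in tgt g ->
  ccomp (del (tgt g) (tgt g) y) g = ccomp (del (tgt g) (tgt g) y') g -> y = y'.
Proof.
move=> Qy Qy' e; have QV : y'^-1 \in tgt g by rewrite groupV.
apply: (mulgI y'^-1); rewrite mulVg; apply: delta_lact_free; first exact: groupM.
by rewrite delta_lactM // e -delta_lactM // mulVg delta_lact1.
Qed.

End ObjectActions.

Definition mres P g : L := ccomp g (del P (src g) 1).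

Section Restriction.
Variables (P : {group S}) (g : L).
Hypotheses (cP : centric F P) (Pg : P \subset src g).
Let ds : src (del P (src g) 1) = P := del_src L cP (cs g) (tsp1 Pg).
Let dt : tgt (del P (src g) 1) = src g := del_tgt L cP (cs g) (tsp1 Pg).

Lemma src_mres : src (mres P g) = P.
Proof. by rewrite /mres (src_comp dt). Qed.

Lemma tgt_mres : tgt (mres P g) = tgt g.
Proof. by rewrite /mres (tgt_comp dt). Qed.

Lemma lpi_mres : lpi (mres P g) = hrestr P (lpi g).
Proof.
rewrite /mres (lpi_comp dt) (linkB L cP (cs g) (tsp1 Pg)) hconj1.
exact: (hrestr_hcomp (lpi_injhom g) Pg).
Qed.

Lemma mres_ccomp h : tgt g = src h -> mres P (ccomp h g) = ccomp h (mres P g).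
Proof. by move=> e; rewrite /mres src_comp // ccompA. Qed.

Lemma mres_mres R : centric F R -> R \subset P -> mres R (mres P g) = mres R g.
Proof.
move=> cR RP; rewrite {1}/mres src_mres /mres.
have dR := del_tgt L cR cP (tsp1 RP).
rewrite -(ccompA (etrans dR (esym ds)) dt).
by rewrite -(delta_comp L cR cP (cs g) (tsp1 RP) (tsp1 Pg)) mulg1.
Qed.

(** This extends axiom (C) to elements x outside P: conjugation by x on P followed by the inclusion
    is the inclusion followed by conjugation on [src g], where (C) holds for g. *)
Lemma mres_delta x : x \in src g -> x \in 'N(P) ->
  ccomp (mres P g) (del P P x) =
  ccomp (del (tgt g) (tgt g) (lpi g x)) (mres P g).
Proof.
move=> gx Nx; have dx := del_tgt L cP cP (tspN Nx).
have ly := injhom_sub (lpi_injhom g) gx.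
have sx := del_src L (cs g) (cs g) (tsp_mem gx).
rewrite /mres -(ccompA (etrans dx (esym ds)) dt).
rewrite -(delta_comp L cP cP (cs g) (tspN Nx) (tsp1 Pg)) mul1g -[in LHS](mulg1 x).
rewrite (delta_comp L cP (cs g) (cs g) (tsp1 Pg) (tsp_mem gx)).
rewrite (ccompA (etrans dt (esym sx)) (tgt_delta_src gx)) ccomp_delta //.
by rewrite (ccompA dt (esym (src_delta_tgt ly))).
Qed.

Lemma mres_ract z : z \in src g -> z \in 'N(P) ->
  mres P (ccomp g (del (src g) (src g) z)) = ccomp (mres P g) (del P P z).
Proof.
move=> gz Nz; rewrite mres_delta // ccomp_delta // mres_ccomp //.
by rewrite src_delta_tgt // (injhom_sub (lpi_injhom g) gz).
Qed.

End Restriction.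

Lemma mres_id g : mres (src g) g = g.
Proof. by rewrite /mres (delta_id L (cs g)) comp_id. Qed.

(* By axiom (C), the restriction of g to the normal subgroup P determines the
   elements lpi g x for all x in src g. *)
Lemma mres_inj_normal P g h : centric F P -> P \subset src g ->
    src g \subset 'N(P) -> src g = src h -> tgt g = tgt h ->
  mres P g = mres P h -> g = h.
Proof.
move=> cP Pg nP es et e.
have Ph : P \subset src h by rewrite -es.
have tm : tgt (mres P g) = tgt g := tgt_mres cP Pg.
have eqpi : lpi g = lpi h.
  have ih := lpi_injhom h; rewrite -es in ih.
  apply: (injhom_eq (lpi_injhom g) ih) => x gx; have Nx := subsetP nP x gx.
  have Qy := injhom_sub (lpi_injhom g) gx.
  have Qy' := injhom_sub ih gx; rewrite -et in Qy'.
  have hx : x \in src h by rewrite -es.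
  have E := mres_delta cP Pg gx Nx; rewrite e (mres_delta cP Ph hx Nx) -e -et in E.
  by apply: (@delta_lact_inj (mres P g)); rewrite tm.
(* Now g and h differ by a central z, which centralizes P and so lies in Z(P) as P is centric; the
   equal restrictions force z = 1 by freeness. *)
have [z Zz eh] := lpi_eqP es et eqpi.
have Cz : z \in 'C(P).
  by move: Zz; rewrite inE => /andP[_]; apply: subsetP; apply: centS.
have Zz' : z \in 'Z(P) by rewrite -(centric_center cP).
have gz := subsetP (center_sub _) z Zz.
suff z1 : z = 1 by rewrite eh z1 delta_ract1.
apply: (@delta_ract_free (mres P g)); rewrite (src_mres cP Pg) //.
by rewrite [in RHS]e eh (mres_ract cP Pg gz (subsetP nP z gz)).
Qed.

Lemma lpi_iso g : is_iso g -> lpi g \in isos F (src g) (tgt g).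
Proof.
move=> /(is_isoP (self_hom g))[h [/chomP[sh th] e1 e2]].
have hh := lpi_fhom h; rewrite sh th in hh.
apply/isosP; exists (lpi h); split=> // [|x hx|x hx]; first exact: lpi_fhom.
  have := congr1 (@lpi _ _ L) e1; rewrite lpi_comp // lpi_id // => /ffunP/(_ x).
  by rewrite !ffunE hx.
have := congr1 (@lpi _ _ L) e2; rewrite lpi_comp // lpi_id // => /ffunP/(_ x).
by rewrite !ffunE hx.
Qed.

(** A lift k of the inverse of [lpi g] is a left inverse of g only up to some z in Z(src g). By
    axiom (C), z can be moved to the left and absorbed into k. *)
Lemma linv_of_lpi_iso g : lpi g \in isos F (src g) (tgt g) ->
  exists h, [/\ h \in chom L (tgt g) (src g), ccomp h g = cid L (src g)
              & lpi h \in isos F (tgt g) (src g)].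
Proof.
move=> ig; have [f [hf c1 c2]] := isos_inv ig.
have [k /chomP[sk tk] ek] := linkA_surj L (ct g) (cs g) (isos_fhom hf).
have hkg : ccomp k g \in chom L (src g) (src g).
  by apply/chomP; rewrite src_comp ?tgt_comp ?sk.
have hid : cid L (src g) \in chom L (src g) (src g).
  by apply/chomP; rewrite src_id ?tgt_id.
have E : lpi (ccomp k g) = lpi (cid L (src g)).
  rewrite lpi_comp ?sk // lpi_id // ek.
  have h1 := fhom_comp (lpi_fhom g) (isos_fhom hf).
  apply: (injhom_eq (fhom_injhom h1) (fhom_injhom (fhom_incl F (subxx _)))).
  by move=> x gx; rewrite !ffunE gx c1.
have [z Zz ez] := (linkA_inj hkg hid).1 E.
have gz := subsetP (center_sub _) z Zz.
have tz := tsp_mem gz.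
have ez2 : ccomp (del (src g) (src g) z) (ccomp k g) = cid L (src g).
  have kg_s : src (ccomp k g) = src g by case/chomP: hkg.
  have kg_t : tgt (ccomp k g) = src g by case/chomP: hkg.
  have := @ccomp_delta (ccomp k g) z; rewrite kg_s kg_t E lpi_id // ffunE gz.
  by move=> <-.
exists (ccomp (del (src g) (src g) z) k); split.
- by apply/chomP; rewrite src_comp ?tgt_comp ?del_src ?del_tgt ?tk.
- by rewrite -ccompA ?del_src ?tk ?sk.
rewrite lpi_comp ?del_src ?tk // linkB // ek.
apply: isos_comp hf _.
have := isos_conj F (src g) z; congr (_ \in isos F _ _).
by apply: val_inj; rewrite /= (normP _) // groupV (subsetP (normG _)).
Qed.

Lemma is_iso_lpi g : is_iso g = (lpi g \in isos F (src g) (tgt g)).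
Proof.
apply/idP/idP=> [|ig]; first exact: lpi_iso.
have [h [/chomP[sh th] e1 ih]] := linv_of_lpi_iso ig.
have ih' : lpi h \in isos F (src h) (tgt h) by rewrite sh th.
(* The left inverse h has a left inverse k in turn; then k = k h g = g, so h is a two-sided inverse
   of g. *)
have [k [/chomP[sk tk] e2 _]] := linv_of_lpi_iso ih'.
apply/(is_isoP (self_hom g)); exists h; split=> //; first exact/chomP.
rewrite -sh -e2; congr (ccomp _ h).
rewrite -[k]comp_id sk th -e1 ccompA ?sh ?sk // e2 sh.
by rewrite id_comp.
Qed.

Section Saturated.
Variable p : nat.
Hypotheses (pS : p.-group [set: S]) (satF : saturated F p).

(** Equality spreads from P to its normalizer in [src g] by the normal case; since normalizers grow
    in p-groups, it climbs up to [src g]. *)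
Lemma mres_inj P g h : centric F P -> P \subset src g ->
    src g = src h -> tgt g = tgt h ->
  mres P g = mres P h -> g = h.
Proof.
have [n] := ubnP (#|src g| - #|P|); elim: n P => // n IHn P lt_n cP Pg es et e.
have Ph : P \subset src h by rewrite -es.
pose N := 'N_(src g)(P)%G.
have PN : P \subset N by rewrite subsetI Pg normG.
have cN := centric_over cP PN.
have Ng : N \subset src g := subsetIl _ _.
have Nh : N \subset src h by rewrite -es.
have eN : mres N g = mres N h.
  apply: (@mres_inj_normal P); rewrite ?src_mres ?tgt_mres ?subsetIr //.
  by rewrite !mres_mres.
case: (boolP (N \subset P)) => NP.
  have eP := pgroup_norm_eq pS Pg NP.
  by rewrite eP mres_id in e; rewrite e es mres_id.
apply: (IHn N) => //; apply: leq_trans (_ : #|src g| - #|P| <= n); last by [].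
rewrite ltn_sub2l ?proper_card // properE ?PN ?NP //.
by rewrite Pg /=; apply: contra NP; apply: subset_trans.
Qed.

(* A lift of f restricts to g up to an element of Z(src g), by which the lift
   can be corrected; hence lpi h need not be f. *)
Lemma lift_extension g R f : src g \subset R -> f \in F R (tgt g) ->
    hrestr (src g) f = lpi g ->
  exists h, [/\ src h = R, tgt h = tgt g & mres (src g) h = g].
Proof.
move=> gR hf e; have cR := centric_over (cs g) gR.
have [k /chomP[sk tk] ek] := linkA_surj L cR (ct g) hf.
have gk : src g \subset src k by rewrite sk.
have [z Zz eg] := @lpi_eqP (mres (src g) k) g (src_mres (cs g) gk)
   (etrans (tgt_mres (cs g) gk) tk)
   (etrans (lpi_mres (cs g) gk) (etrans (congr1 _ ek) e)).
rewrite (src_mres (cs g) gk) in Zz eg.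
have gz := subsetP (center_sub _) z Zz.
have kz := subsetP gk z gz.
exists (ccomp k (del (src k) (src k) z)).
rewrite (src_comp (tgt_delta_src kz)) (tgt_comp (tgt_delta_src kz)) tk.
rewrite (del_src L (cs k) (cs k) (tsp_mem kz)) sk; split=> //.
rewrite -sk (mres_ract (cs g) gk kz); first exact: esym eg.
exact: subsetP (normG _) z gz.
Qed.

End Saturated.
End LinkingTheory.

(** * Nonextendable isomorphisms *)

Section BisetStabilizers.
Variables (S : finGroupType) (W : biset S).
Implicit Types (w : W) (u : S * S) (D : {set S * S}).

Lemma mem_stab w u : (u \in 'C[w | bact W]) = (ract w u.2 == lact u.1 w).
Proof.
apply/astab1P/eqP => /= [|e]; rewrite /bact_fun.
  by rewrite -lractA => {2}<-; rewrite -lactM mulgV lact1.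
by rewrite -lractA e -lactM mulVg lact1.
Qed.

Lemma mem_fix w D : (w \in 'Fix_(bact W)(D)) = (D \subset 'C[w | bact W]).
Proof.
apply/afixP/subsetP=> h u /h; last by move/astab1P.
by move=> e; apply/astab1P.
Qed.

Lemma nfix_gt0 P f : reflect (exists w : W, tdiag P f \subset 'C[w | bact W])
  (0 < nfix W P f).
Proof.
rewrite /nfix card_gt0; apply: (iffP (set0Pn _)) => -[w].
  by rewrite mem_fix => h; exists w.
by exists w; rewrite mem_fix.
Qed.

End BisetStabilizers.

Section NonextendableIsos.
Variables (S : finGroupType) (F : fusion_system S) (L : linking_system F).
Implicit Types (P Q R : {group S}) (f : {ffun S -> S}) (g h m : L) (x y z : S).
Local Notation SG := [set: S]%G.
Local Notation del := (delta L).
Let cs g : centric F (src g) := src_obj g.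
Let ct g : centric F (tgt g) := tgt_obj g.

Lemma src_incl g : src (del (tgt g) SG 1) = tgt g.
Proof. exact: (@del_src _ _ L _ _ _ (ct g) (centricT F) (tsp1 (subsetT _))). Qed.

Lemma tgt_incl g : tgt (del (tgt g) SG 1) = SG.
Proof. exact: (@del_tgt _ _ L _ _ _ (ct g) (centricT F) (tsp1 (subsetT _))). Qed.

(* Isomorphisms of L correspond under [hat] to the morphisms with target S,
   and extension to the order [mle]. *)
Definition hat g : L := ccomp (del (tgt g) SG 1) g.

Lemma src_hat g : src (hat g) = src g.
Proof. by rewrite /hat src_comp ?src_incl. Qed.

Lemma tgt_hat g : tgt (hat g) = SG.
Proof. by rewrite /hat tgt_comp ?src_incl ?tgt_incl. Qed.

Lemma lpi_hat g : lpi (hat g) = lpi g.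
Proof.
rewrite /hat lpi_comp ?src_incl // (linkB L (ct g) (centricT F) (tsp1 (subsetT _))).
rewrite hconj1; have h := fhom_comp (lpi_fhom g) (fhom_incl F (subxx (tgt g))).
apply: injhom_eq (fhom_injhom h) (lpi_injhom g) _ => x gx.
by rewrite !ffunE (injhom_sub (lpi_injhom g) gx).
Qed.

Lemma hat_comp g h : tgt h = src g ->
  hat (ccomp g h) = ccomp (hat g) h.
Proof. by move=> e; rewrite /hat tgt_comp // ccompA // src_incl. Qed.

Lemma mres_hat P g : centric F P -> P \subset src g ->
  mres P (hat g) = hat (mres P g).
Proof.
move=> cP Pg; rewrite [in RHS]/mres hat_comp ?/mres ?src_hat //.
exact: (del_tgt L cP (cs g) (tsp1 Pg)).
Qed.

(** The inclusion of the target in S is monic: g and h have the same [lpi], so they differ by a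
    central z, and freeness on [hat g] gives z = 1. *)
Lemma hat_inj g h : src g = src h -> tgt g = tgt h -> hat g = hat h -> g = h.
Proof.
move=> es et e; have el : lpi g = lpi h by rewrite -lpi_hat e lpi_hat.
have [z Zz eh] := lpi_eqP es et el.
have gz := subsetP (center_sub _) z Zz.
have Zz' : z \in 'Z(src (hat g)) by rewrite src_hat.
rewrite eh (delta_ract_free Zz') ?(delta_id L (cs g)) ?comp_id //.
rewrite src_hat [in RHS]e eh hat_comp //.
exact: (del_tgt L (cs g) (cs g) (tsp_mem gz)).
Qed.

(** The isomorphism of [src m] onto the image of [lpi m] lifts to [L]; its composite with the
    inclusion is m up to a central element, which is moved into the lift. *)
Lemma hat_surj m : tgt m = SG -> exists2 g, is_iso g & hat g = m.
Proof.
move=> tm; have [R [eR _ iso]] := fhom_im (lpi_fhom m).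
have cR := centric_fiso (fiso_isos iso) (cs m).
have [k /chomP[sk tk] ek] := linkA_surj L (cs m) cR (isos_fhom iso).
have [z Zz em] := @lpi_eqP _ _ _ (hat k) m (etrans (src_hat k) sk)
  (etrans (tgt_hat k) (esym tm)) (etrans (lpi_hat k) ek).
rewrite src_hat in Zz em.
have kz := subsetP (center_sub _) z Zz.
have tz := del_tgt L (cs k) (cs k) (tsp_mem kz).
exists (ccomp k (del (src k) (src k) z)); last by rewrite em hat_comp.
apply: is_iso_comp; rewrite ?tz //; last by rewrite is_iso_lpi ek sk tk.
have ek2 : (src k :^ z^-1)%G = src k.
  by apply: val_inj; rewrite /= (normP _) // groupV (subsetP (normG _)).
by have := @is_iso_delta _ _ L (src k) z (cs k); rewrite ek2.
Qed.

Lemma iso_tgt g : is_iso g -> tgt g = lpi g @: src g :> {set S}.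
Proof. by rewrite is_iso_lpi => /isos_im. Qed.

Lemma iso_hat_inj g h : is_iso g -> is_iso h -> hat g = hat h -> g = h.
Proof.
move=> ig ih e; have es : src g = src h by rewrite -src_hat e src_hat.
apply: hat_inj => //; apply: val_inj; rewrite /= (iso_tgt ig) (iso_tgt ih) es.
by rewrite -[lpi g]lpi_hat e lpi_hat.
Qed.

(** The condition on targets comes for free: an isomorphism is onto its target, so the target of g
    lies in that of h as soon as [lpi g] is a restriction of [lpi h]. *)
Lemma extends_hat g h : is_iso g -> is_iso h ->
  extends h g = (src g \subset src h) && (mres (src g) (hat h) == hat g).
Proof.
move=> ig ih; rewrite /extends; case: (boolP (src g \subset src h)) => //= gh.
rewrite mres_hat // -/(mres (src g) h).
apply/andP/eqP => [[tgh /eqP e]|e].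
  rewrite {1}/hat tgt_mres // e ccompA ?src_incl ?del_src ?del_tgt ?tsp1 //.
  by rewrite -(delta_comp L (ct g) (ct h) (centricT F)) ?mul1g ?tsp1 ?subsetT.
have tgh : tgt g \subset tgt h.
  have el : lpi g = hrestr (src g) (lpi h).
    by rewrite -lpi_mres // -lpi_hat -e lpi_hat.
  rewrite (iso_tgt ig) el; apply/subsetP=> _ /imsetP[x gx ->].
  by rewrite ffunE gx (injhom_sub (lpi_injhom h)) // (subsetP gh).
split=> //; apply/eqP; apply: hat_inj.
- by rewrite src_mres // src_comp ?del_src ?tsp1.
- by rewrite tgt_mres // tgt_comp ?del_src ?del_tgt ?tsp1.
rewrite e /hat tgt_comp ?del_src ?del_tgt ?tsp1 //.
rewrite ccompA ?src_incl ?del_src ?del_tgt ?tsp1 //.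
by rewrite -(delta_comp L (ct g) (ct h) (centricT F)) ?mul1g ?tsp1 ?subsetT.
Qed.

Definition mle m m' := [&& src m \subset src m', tgt m == tgt m'
  & mres (src m) m' == m].

Definition mmax m := [forall m', mle m m' ==> (src m' \subset src m)].

Lemma mleP m m' : reflect
  [/\ src m \subset src m', tgt m = tgt m' & mres (src m) m' = m] (mle m m').
Proof. by apply: (iffP and3P) => -[h /eqP e1 /eqP e2]; split=> //; apply/eqP. Qed.

Lemma mle_refl m : mle m m.
Proof. by apply/mleP; rewrite mres_id. Qed.

Lemma mle_trans m1 m2 m3 : mle m1 m2 -> mle m2 m3 -> mle m1 m3.
Proof.
move=> /mleP[s12 t12 e12] /mleP[s23 t23 e23]; apply/mleP.
rewrite (subset_trans s12) // t12; split=> //.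
by rewrite -[RHS]e12 -[in RHS]e23 mres_mres.
Qed.

Lemma mle_mres P m : centric F P -> P \subset src m -> mle (mres P m) m.
Proof.
by move=> cP Pm; apply/mleP; rewrite !src_mres // tgt_mres.
Qed.

Lemma mle_eq m m' : mle m m' -> src m' \subset src m -> m' = m.
Proof.
move=> /mleP[s _ e] s'; rewrite -e.
have -> : src m = src m' by apply: val_inj; apply/eqP; rewrite eqEsubset s.
by rewrite mres_id.
Qed.

Lemma mmax_eq m m' : mmax m -> mle m m' -> m' = m.
Proof. by move/forallP/(_ m')/implyP=> h mm'; apply: mle_eq (h mm'). Qed.

Lemma exists_mmax m : exists2 m', mle m m' & mmax m'.
Proof.
have [m' mm' mx] := arg_maxnP (fun m' => #|src m'|) (mle_refl m).
exists m' => //; apply/forallP=> m2; apply/implyP=> m'2.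
have := mx _ (mle_trans mm' m'2); case/mleP: m'2 => s _ _ le.
suff /eqP-> : src m' :==: src m2 by [].
by rewrite eqEcard s.
Qed.

Lemma nonextendableE g : nonextendable g = is_iso g && mmax (hat g).
Proof.
rewrite /nonextendable; case ig: (is_iso g) => //=.
apply/idP/forallP => [nx m'|mx].
  apply/implyP=> /mleP[]; rewrite src_hat tgt_hat => s /esym/hat_surj[h ih eh] e.
  rewrite -eh !src_hat in s e *; apply: contraR nx => ns.
  apply/existsP; exists h; rewrite ih properE s ns /= extends_hat // s /=.
  by rewrite e eqxx.
apply/existsP=> -[h /and3P[ih]]; rewrite extends_hat // => /andP[s e].
rewrite properE => /andP[_]; have := mx (hat h).
by rewrite /mle !src_hat !tgt_hat s e eqxx => /= ->.
Qed.

Variable p : nat.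
Hypotheses (pS : p.-group [set: S]) (satF : saturated F p).

Lemma sub_Nphi_src m : src m \subset Nphi (src m) (lpi m).
Proof.
have h := fhom_codomT (lpi_fhom m).
apply: subset_trans (sub_Nphi (subxx _) h h (hrestr_id (lpi_injhom m))).
by rewrite subsetI subxx normG.
Qed.

Lemma exists_ext_Nphi m : tgt m = SG ->
  exists2 m', mle m m' & src m' = Nphi_group (src m) (lpi m).
Proof.
move=> tm; have hl := lpi_fhom m; rewrite tm in hl.
have [f hf ef] := centric_extension satF (cs m) hl.
have hf' : f \in F (Nphi_group (src m) (lpi m)) (tgt m) by rewrite tm.
have [k [sk tk ek]] := lift_extension (sub_Nphi_src m) hf' ef.
by exists k => //; apply/mleP; rewrite sk tk sub_Nphi_src.
Qed.

Lemma mmax_Nphi m : tgt m = SG -> mmax m -> Nphi (src m) (lpi m) = src m.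
Proof.
move=> tm mx; have [m' mm' sm'] := exists_ext_Nphi tm.
apply/eqP; rewrite eqEsubset sub_Nphi_src andbT.
by have := implyP (forallP mx m') mm'; rewrite sm'.
Qed.

(* Both maximal extensions are compared with one of an extension of m to
   N_(lpi m), which contains N_R(src m) for the source R of any extension. *)
Lemma mmax_uniq m m1 m2 : tgt m = SG -> mle m m1 -> mle m m2 ->
  mmax m1 -> mmax m2 -> m1 = m2.
Proof.
have [n] := ubnP (#|[set: S]| - #|src m|).
elim: n m m1 m2 => // n IHn m m1 m2 lt_n tm mm1 mm2 mx1 mx2.
have [m' mm' sm'] := exists_ext_Nphi tm.
have [m3 m'3 mx3] := exists_mmax m'.
(* If the normalizer grows inside [src k], then k and [m3] restrict to the same morphism on it,
   because both extend m. Induction applies to this larger common restriction. *)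
have step k : mle m k -> mmax k -> ~~ ('N_(src k)(src m) \subset src m) -> k = m3.
  move=> mk mxk nN; case/mleP: (mk) => s t e.
  pose N := 'N_(src k)(src m)%G.
  have PN : src m \subset N by rewrite subsetI s normG.
  have Nk : N \subset src k := subsetIl _ _.
  have cN := centric_over (cs m) PN.
  have N3 : N \subset src m3.
    case/mleP: m'3 => s3 _ _; apply: subset_trans s3; rewrite sm' /=.
    apply: (sub_Nphi s); rewrite -?tm; first exact: lpi_fhom.
      by rewrite t; apply: lpi_fhom.
    by rewrite -(lpi_mres (cs m) s) e.
  have mm3 := mle_trans mm' m'3; case/mleP: (mm3) => s3 t3 e3.
  have eN : mres N k = mres N m3.
    apply: (mres_inj pS (cs m)); rewrite ?src_mres ?tgt_mres -?t -?t3 //.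
    by rewrite (mres_mres cN Nk (cs m) PN) (mres_mres cN N3 (cs m) PN) e e3.
  apply: (IHn (mres N k)); rewrite ?src_mres ?tgt_mres -?t ?mle_mres //.
    rewrite -ltnS; apply: leq_trans lt_n; rewrite ltnS ltn_sub2l //.
      apply: leq_trans (subset_leq_card (subsetT N)).
      by rewrite proper_card // properE PN.
    by rewrite proper_card // properE PN.
  by rewrite eN mle_mres.
(* If it does not grow, then [src k] is [src m], so k is m itself; m is then maximal and has no
   other extension. *)
have stop k k' : mle m k -> mmax k -> mle m k' ->
    'N_(src k)(src m) \subset src m -> k = k'.
  move=> mk mxk mk' NP; case/mleP: (mk) => s _ _.
  have es := pgroup_norm_eq pS s NP.
  have ek : k = m by apply: mle_eq mk _; rewrite es.
  by rewrite -ek in mk'; rewrite (mmax_eq mxk mk').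
case: (boolP ('N_(src m1)(src m) \subset src m)) => [|n1]; first exact: stop.
case: (boolP ('N_(src m2)(src m) \subset src m)) => [|n2].
  by move=> h; symmetry; apply: stop h.
by rewrite (step m1) // (step m2).
Qed.

End NonextendableIsos.

(** * The group Aut_F(P), and its order for P = S *)

Section Automizers.
Variables (S : finGroupType) (F : fusion_system S).
Implicit Types (P Q R : {group S}) (f : {ffun S -> S}) (a b : {perm S}).
Local Notation SG := [set: S]%G.

Lemma AutFP P a : reflect (a \in Aut P /\ hrestr P (finfun a) \in F P P)
  (a \in AutF F P).
Proof.
have -> : hrestr P (finfun a) = [ffun x => if x \in P then a x else 1].
  by apply/ffunP=> x; rewrite !ffunE.
have -> : (a \in AutF F P) =
    (a \in Aut P) && ([ffun x => if x \in P then a x else 1] \in F P P).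
  exact: in_set.
exact: andP.
Qed.

Lemma AutF_of_fhom P f : f \in F P P -> exists2 a, a \in AutF F P & {in P, a =1 f}.
Proof.
move=> hf; have h := fhom_injhom hf; case/injhomP: (h) => fM fI fP _.
have E : {in P, perm_in fI fP =1 f} by move=> x Px; rewrite perm_inE.
exists (perm_in fI fP) => //; apply/AutFP; split.
  rewrite inE perm_in_on; apply/morphicP=> x y Px Py.
  by rewrite !E ?groupM ?fM.
rewrite -[X in X \in _](_ : f = _) //; apply/ffunP=> x; rewrite !ffunE.
by case: ifPn => [/E->//|/(injhom_out h)].
Qed.

Lemma AutF_group_set P : group_set (AutF F P).
Proof.
apply/group_setP; split.
  apply/AutFP; rewrite group1; split=> //.
  rewrite (_ : hrestr _ _ = hincl P) ?fhom_incl //.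
  by apply/ffunP=> x; rewrite !ffunE perm1.
move=> a b /AutFP[Aa ha] /AutFP[Ab hb]; apply/AutFP; rewrite groupM //; split=> //.
rewrite (_ : hrestr _ _ = hcomp (hrestr P (finfun b)) (hrestr P (finfun a))).
  exact: fhom_comp ha hb.
apply/ffunP=> x; rewrite !ffunE permM; case: (boolP (x \in P)) => Px.
  by rewrite (Aut_closed Aa Px).
by rewrite group1; have := injhom1 (fhom_injhom hb); rewrite !ffunE group1.
Qed.
Canonical AutF_group P := Group (AutF_group_set P).

Lemma card_AutF P : #|AutF F P| = #|F P P|.
Proof.
rewrite -(@card_in_imset _ _ (fun a : {perm S} => hrestr P (finfun a))).
  apply: eq_card => f; apply/imsetP/idP=> [[a /AutFP[_ ha] ->]//|hf].
  have [a ha E] := AutF_of_fhom hf; exists a => //; apply/ffunP=> x.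
  by rewrite !ffunE; case: ifPn => [/E->//|/(injhom_out (fhom_injhom hf))].
move=> a b /AutFP[Aa _] /AutFP[Ab _] e; apply: (eq_Aut Aa Ab) => x Px.
by move/ffunP/(_ x): e; rewrite !ffunE Px.
Qed.

Lemma fully_normalizedT : fully_normalized F SG.
Proof.
apply/forallP=> Q; apply/implyP=> /fiso_card eQ.
suff -> : Q = SG by [].
by apply: val_inj; apply/eqP; rewrite eqEcard subsetT /= -eQ leqnn.
Qed.

(** S is fully normalized, so Inn(S), of order |S : Z(S)|, is a Sylow p-subgroup of Aut_F(S). The
    number k is its index, the order of Out_F(S). *)
Lemma card_fhomT p : prime p -> saturated F p ->
  exists2 k, ~~ (p %| k) & (#|F SG SG| * #|'Z(SG)| = #|[set: S]| * k)%N.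
Proof.
move=> pp [sat _]; have [_ /and3P[sA _ pA]] := sat _ fully_normalizedT.
exists #|AutF F SG : AutS SG|; first by rewrite -p'natE.
have e : (#|AutS SG| * #|'Z(SG)|)%N = #|[set: S]|.
  rewrite /AutS card_morphim ker_conj_aut setIid /=.
  have -> : 'N([set: S]) = [set: S] by apply/setP=> x; rewrite (subsetP (normG _)) ?inE.
  have -> : 'C([set: S]) = 'Z([set: S]) by rewrite /center setTI.
  by rewrite mulnC Lagrange ?subsetT.
by rewrite -card_AutF -(Lagrange sA) mulnAC e.
Qed.

End Automizers.

(** * The degree of a biset modulo p *)

Section Degree.
Variables (p : nat) (S : finGroupType) (W : biset S).
Hypotheses (pp : prime p) (pS : p.-group [set: S]).
Implicit Types (Q : {group S}) (f : {ffun S -> S}) (w : W) (A : {set W}).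
Local Notation SG := [set: S]%G.

(** An orbit with stabilizer (Q, f) has |S| |S : Q| points, and p divides |S : Q| when Q is
    proper. *)
Lemma card_proper_points A : 
    (forall a w b, (ract (lact a w) b \in A) = (w \in A)) ->
    (forall w, w \in A -> exists Q f, [/\ f \in injhom Q SG, Q \proper SG
       & 'C[w | bact W] = tdiag Q f]) ->
  (p * #|[set: S]|)%N %| #|A|.
Proof.
move=> clA stA.
have actA : [acts [set: S * S], on A | bact W].
  apply/subsetP=> u _; rewrite !inE /=; apply/subsetP=> w Aw.
  by rewrite inE /= /bact_fun clA.
rewrite -(acts_sum_card_orbit actA); apply: dvdn_sum => _ /imsetP[w Aw ->].
have [Q [f [hf QS est]]] := stA w Aw.
have := card_orbit_stab (bact W) [set: S * S] w.
have eSS : #|[set: S * S]| = (#|[set: S]| * #|[set: S]|)%N.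
  by rewrite !cardsT; exact: card_prod.
have eS : (#|Q| * #|SG : Q|)%N = #|[set: S]| := Lagrange (proper_sub QS).
rewrite setTI est card_tdiag eSS -{1}eS -mulnA [RHS]mulnC => /eqP.
rewrite eqn_pmul2r // => /eqP->.
rewrite dvdn_mul //.
have q1 : 1 < #|SG : Q| by rewrite indexg_gt1; case/andP: QS.
have pq : p.-nat #|SG : Q| by apply: pnat_dvd (dvdn_indexg _ _) pS.
have := pnatPpi pq (_ : pdiv #|SG : Q| \in _); rewrite pi_pdiv q1 => /(_ isT).
by move/eqP <-; apply: pdiv_dvd.
Qed.

Lemma degree_setC A : (p * #|[set: S]|)%N %| #|~: A| ->
  degree_prime_to_p p W <-> ~~ (p %| #|A| %/ #|[set: S]|).
Proof.
case/dvdnP=> c e; rewrite /degree_prime_to_p -(cardsC A) e mulnA addnC.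
by rewrite divnMDl ?cardG_gt0 // dvdn_addr // dvdn_mull.
Qed.

End Degree.

(** * Stabilizers, fixed points and degree of the biset of nonextendable isomorphisms *)

Section NonextendableBiset.
Variables (p : nat) (S : finGroupType) (F : fusion_system S) (L : linking_system F).
Implicit Types (P Q R : {group S}) (f : {ffun S -> S}) (g h m : L) (a b x y z : S).
Local Notation SG := [set: S]%G.
Local Notation del := (delta L).
Local Notation J := (nonext_biset L).
Implicit Types (w : J).
Let cs g : centric F (src g) := src_obj g.
Let ct g : centric F (tgt g) := tgt_obj g.

Lemma card_lifts P Q f : centric F P -> centric F Q -> f \in F P Q ->
  #|[set m in chom L P Q | lpi m == f]| = #|'Z(P)|.
Proof.
move=> cP cQ hf; have [m0 /chomP[s0 t0] e0] := linkA_surj L cP cQ hf.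
have ZP := subsetP (center_sub P).
have sd z : z \in 'Z(P) -> src (del P P z) = P /\ tgt (del P P z) = src m0.
  move=> /ZP Pz; rewrite (del_src L cP cP (tsp_mem Pz)).
  by rewrite (del_tgt L cP cP (tsp_mem Pz)) s0.
have dM z z' : z \in 'Z(P) -> z' \in 'Z(P) ->
    ccomp (ccomp m0 (del P P z)) (del P P z') = ccomp m0 (del P P (z * z')).
  move=> Zz Zz'; have [sz tz] := sd z Zz; have [sz' tz'] := sd z' Zz'.
  rewrite (delta_comp L cP cP cP) ?(tsp_mem (ZP _ Zz)) ?(tsp_mem (ZP _ Zz')) //.
  by rewrite ccompA ?tz ?tz' ?sz ?s0.
have m0P : m0 \in chom L P Q by apply/chomP.
have m0z z : z \in 'Z(P) -> ccomp m0 (del P P z) \in chom L P Q.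
  move=> Zz; have [sz tz] := sd z Zz.
  by apply/chomP; rewrite src_comp ?tgt_comp ?sz ?tz.
rewrite -(@card_in_imset _ _ (fun z => ccomp m0 (del P P z)) 'Z(P)).
  apply: eq_card => m; rewrite inE; apply/andP/imsetP => [[hm /eqP em]|[z Zz ->]].
    by have [z Zz ez] := (linkA_inj m0P hm).1 (etrans e0 (esym em)); exists z.
  split; first exact: m0z.
  by rewrite -e0; apply/eqP/esym/(linkA_inj m0P (m0z z Zz)); exists z.
move=> z z' Zz Zz' /= e; apply: (mulIg z'^-1); rewrite mulgV.
have ZV : z'^-1 \in 'Z(P) by rewrite groupV.
apply: (linkA_free m0P); rewrite ?groupM //.
rewrite -dM // e dM // mulgV (delta_id L cP) -s0.
by rewrite comp_id.
Qed.

Definition arrow w : L := sval w.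

Lemma arrow_inj : injective arrow. Proof. exact: val_inj. Qed.

Lemma arrow_iso w : is_iso (arrow w).
Proof. by case/andP: (valP w). Qed.

Lemma arrow_mmax w : mmax (hat (arrow w)).
Proof. by have := valP w; rewrite nonextendableE => /andP[]. Qed.

Lemma arrow_surj g : nonextendable g -> exists w, arrow w = g.
Proof. by move=> ng; exists (exist _ g ng). Qed.

Lemma arr_ract_lpi g a : a \in src g -> arr_ract g a = arr_lact (lpi g a) g.
Proof.
move=> ga; have e1 : (src g :^ a)%G = src g.
  by apply: val_inj; rewrite /= (normP _) // (subsetP (normG _)).
have e2 : (tgt g :^ (lpi g a)^-1)%G = tgt g.
  apply: val_inj; rewrite /= (normP _) // groupV (subsetP (normG _)) //.
  exact: injhom_sub (lpi_injhom g) ga.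
by rewrite /arr_ract e1 /arr_lact e2; apply: ccomp_delta.
Qed.

(** Comparing sources and targets puts a and b in the normalizers of the two objects; applying [lpi]
    then makes b the witness required by [Nphi]. *)
Lemma arr_ract_Nphi g a b : is_iso g -> arr_ract g a = arr_lact b g ->
  a \in Nphi (src g) (lpi g).
Proof.
move=> ig e.
have e1 : (src g :^ a)%G = src g.
  by have := congr1 (@src _ _ _) e; rewrite src_arr_ract src_arr_lact.
have e2 : (tgt g :^ b^-1)%G = tgt g.
  by have := congr1 (@tgt _ _ _) e; rewrite tgt_arr_ract tgt_arr_lact.
have Na : a \in 'N(src g) by apply/normP; exact: (congr1 (@gval S) e1).
have Nb : b \in 'N(tgt g) by rewrite -groupV; apply/normP; exact: (congr1 (@gval S) e2).
move: e; rewrite /arr_ract e1 /arr_lact e2 => /(congr1 (@lpi _ _ L)).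
have ta := del_tgt L (cs g) (cs g) (tspN Na).
have sb := del_src L (ct g) (ct g) (tspN Nb).
rewrite !lpi_comp ?ta ?sb // (linkB L (cs g) (cs g) (tspN Na)).
rewrite (linkB L (ct g) (ct g) (tspN Nb)) => /ffunP E.
rewrite in_Nphi Na /=; apply/existsP; exists b; rewrite -(iso_tgt ig) Nb /=.
apply/forall_inP=> x gx; have := E x.
by rewrite !ffunE gx (injhom_sub (lpi_injhom g) gx) => ->.
Qed.

Hypotheses (pp : prime p) (pS : p.-group [set: S]) (satF : saturated F p).

Lemma arrow_Nphi w : Nphi (src (arrow w)) (lpi (arrow w)) = src (arrow w).
Proof.
have := mmax_Nphi satF (tgt_hat _) (arrow_mmax w).
by rewrite src_hat lpi_hat.
Qed.

(** Axiom (C) says that the graph fixes w. Conversely, if (b, a) fixes w, then a lies in N_psi,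
    which is the source by maximality, and b is determined by a because the left action is free. *)
Lemma nonext_stab w : 'C[w | bact J] = tdiag (src (arrow w)) (lpi (arrow w)).
Proof.
have actP a b : (ract w a == lact b w) = (arr_ract (arrow w) a == arr_lact b (arrow w)).
  exact: val_eqE.
have key a : a \in src (arrow w) -> ract w a = lact (lpi (arrow w) a) w.
  move=> ga; apply/eqP; rewrite actP; apply/eqP; exact: arr_ract_lpi.
apply/setP=> -[b a]; rewrite mem_tdiag.
have -> : ((b, a) \in 'C[w | bact J]) = (ract w a == lact b w).
  exact: mem_stab w (b, a).
apply/eqP/andP=> [e|[ga /eqP->]].
  have ga : a \in src (arrow w).
    rewrite -arrow_Nphi; apply: (arr_ract_Nphi (b := b) (arrow_iso w)).
    by apply/eqP; rewrite -actP; apply/eqP.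
  split=> //; apply/eqP; move: e; rewrite key // => e.
  apply: (mulgI (lpi (arrow w) a)^-1); rewrite mulVg.
  apply: (@lact_free _ _ _ w); rewrite lactM -e -lactM mulVg; exact: lact1.
exact: key.
Qed.

Lemma arrow_fhom w : lpi (arrow w) \in F (src (arrow w)) SG.
Proof. exact: fhom_codomT (lpi_fhom _). Qed.

Lemma nonext_fgenerated : fgenerated F J.
Proof.
move=> w; exists (src (arrow w)), (lpi (arrow w)).
by rewrite arrow_fhom nonext_stab.
Qed.

Lemma nonext_fixE w P f : f \in F P SG ->
  (w \in 'Fix_(bact J)(tdiag P f)) =
  (P \subset src (arrow w)) && (hrestr P (lpi (arrow w)) == f).
Proof.
move=> hf; rewrite mem_fix nonext_stab.
exact: tdiag_sub (fhom_injhom hf) (lpi_injhom _).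
Qed.

Lemma nfix_nonext P f : centric F P -> f \in F P SG -> nfix J P f = #|'Z(P)|.
Proof.
move=> cP hf; rewrite /nfix -(card_lifts cP (centricT F) hf).
(* The bijection from fixed points to lifts: a lift is reached from any maximal extension of it, and
   [mmax_uniq] gives injectivity. *)
pose phi w := mres P (hat (arrow w)).
have mle_phi w : w \in 'Fix_(bact J)(tdiag P f) ->
    [/\ mle (phi w) (hat (arrow w)), tgt (phi w) = SG, src (phi w) = P &
    lpi (phi w) = f].
  rewrite nonext_fixE // => /andP[Pw /eqP ew].
  have Pw' : P \subset src (hat (arrow w)) by rewrite src_hat.
  rewrite /phi (tgt_mres cP Pw') (src_mres cP Pw') (lpi_mres cP Pw').
  by rewrite tgt_hat lpi_hat ew mle_mres.
rewrite -(@card_in_imset _ _ phi).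
  apply: eq_card => m; rewrite inE; apply/imsetP/andP => [[w /mle_phi[_ t s l] ->]|].
    by split; [apply/chomP | rewrite l].
  case=> /chomP[sm tm] /eqP lm; have [m' mm' mx'] := exists_mmax m.
  case/mleP: (mm') => smm' tmm' em'; rewrite tm in tmm'.
  have [g ig eg] := hat_surj (esym tmm').
  have [w ew] : exists w, arrow w = g.
    by apply: arrow_surj; rewrite nonextendableE ig eg.
  have Pm' : P \subset src m' by rewrite -sm.
  exists w; last by rewrite /phi ew eg -sm em'.
  rewrite nonext_fixE // ew -src_hat -lpi_hat eg Pm' /=.
  by rewrite -(lpi_mres cP Pm') -sm em' lm.
move=> w1 w2 F1 F2 e; have [m1 t1 s1 _] := mle_phi _ F1; have [m2 _ _ _] := mle_phi _ F2.
rewrite -e in m2.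
have eh := mmax_uniq pS satF t1 m1 m2 (arrow_mmax w1) (arrow_mmax w2).
exact: arrow_inj (iso_hat_inj (arrow_iso w1) (arrow_iso w2) eh).
Qed.

Lemma arrow_act a w b :
  arrow (ract (lact a w) b) = arr_ract (arr_lact a (arrow w)) b.
Proof. by []. Qed.

Lemma src_arrow_act a w b : src (arrow (ract (lact a w) b)) = (src (arrow w) :^ b)%G.
Proof. by rewrite arrow_act src_arr_ract src_arr_lact. Qed.


Lemma card_chomT k : (#|F SG SG| * #|'Z(SG)| = k)%N -> #|chom L SG SG| = k.
Proof.
move<-; rewrite -sum1_card (partition_big (@lpi _ _ L) (mem (F SG SG))) /=.
  rewrite -sum_nat_const; apply: eq_bigr => f hf; have cT := centricT F.
  rewrite sum1_card -(card_lifts cT cT hf); apply: eq_card => m.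
  by rewrite [RHS]in_set.
by move=> m; apply: lpi_hom.
Qed.

Lemma src_arrowT g : src g = SG -> exists w, arrow w = g.
Proof.
move=> sg; have tg : tgt g = SG.
  apply: val_inj; apply/eqP; rewrite eqEcard subsetT /=.
  have := subset_leq_card (_ : lpi g @: src g \subset tgt g).
  rewrite (card_injhom (lpi_injhom g)) sg; apply.
  by rewrite -sg; case/injhomP: (lpi_injhom g).
apply: arrow_surj; rewrite nonextendableE is_iso_lpi sg tg; apply/andP; split.
  have hg := lpi_fhom g; rewrite sg tg in hg; apply: fhom_isos (hg) _.
  by apply/eqP; rewrite eqEcard subsetT (card_injhom (fhom_injhom hg)) /=.
by apply/forallP=> m; rewrite src_hat sg subsetT implybT.
Qed.

Lemma nonext_degree : degree_prime_to_p p J.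
Proof.
have [k pk ek] := card_fhomT pp satF.
(* The arrows with source S are the automorphisms of S in [L], |S| k in number. All other orbits
   have proper sources and vanish from the degree modulo p. *)
pose B := [set w | src (arrow w) == SG].
have cB : #|B| = (#|[set: S]| * k)%N.
  rewrite -(card_chomT ek) -(card_imset B arrow_inj); apply: eq_card => g.
  apply/imsetP/chomP => [[w]|[sg tg]].
    rewrite inE => /eqP sw ->; split=> //; apply: val_inj; apply/eqP.
    rewrite /= eqEcard subsetT (iso_tgt (arrow_iso w)).
    by rewrite (card_injhom (lpi_injhom _)) sw /=.
  by have [w ew] := src_arrowT sg; exists w; rewrite ?inE ew ?sg.
have dA : (p * #|[set: S]|)%N %| #|~: B|.
  apply: card_proper_points => // [a w b|w].
    rewrite !inE src_arrow_act; congr (~~ _).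
    have eqT Q : (Q == SG) = (#|[set: S]| <= #|Q|).
      by rewrite -val_eqE eqEcard subsetT.
    by rewrite !eqT cardJg.
  rewrite !inE => sw; exists (src (arrow w)), (lpi (arrow w)).
  rewrite nonext_stab (fhom_injhom (arrow_fhom w)); split=> //.
  by rewrite properEneq subsetT andbT.
by apply/(degree_setC dA); rewrite cB mulKn.
Qed.

Lemma nonext_centric_characteristic : centric_characteristic p F J.
Proof.
split; [exact: nonext_fgenerated | | | exact: nonext_degree].
  move=> w; exists (src (arrow w)), (lpi (arrow w)); split; last exact: nonext_stab.
    exact: cs.
  exact: fhom_injhom (arrow_fhom w).
move=> P f cP hf; have [R [eR _ iso]] := fhom_im hf.
have hi : hincl P \in F P SG by apply: fhom_codomT (fhom_incl F (subxx P)).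
have [hv _ _] := isos_hinv iso.
have cR := centric_fiso (fiso_isos iso) cP.
rewrite eR (nfix_nonext cP hf) (nfix_nonext cP hi).
rewrite (nfix_nonext cR (fhom_codomT (isos_fhom hv))).
by rewrite (fiso_card_center (fiso_isos iso)).
Qed.

(** Equal stabilizers mean equal sources and equal [lpi]; the targets, being images, agree too. The
    two arrows then differ by a central z, that is, by the right action of z. *)
Lemma nonext_orbit w w' : 'C[w | bact J] = 'C[w' | bact J] ->
  w' \in orbit (bact J) [set: S * S] w.
Proof.
rewrite !nonext_stab.
case/(tdiag_inj (lpi_injhom _) (lpi_injhom _)) => es el.
have et : tgt (arrow w) = tgt (arrow w').
  by apply: val_inj; rewrite /= !(iso_tgt (arrow_iso _)) es el.
have [z Zz ew] := lpi_eqP es et el.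
have gz := subsetP (center_sub _) z Zz.
apply/orbitP; exists (1, z); rewrite ?inE //; apply: arrow_inj.
rewrite -[bact J w (1, z)]/(ract (lact 1^-1 w) z) arrow_act invg1 arr_lact1 ew /arr_ract.
suff -> : (src (arrow w) :^ z)%G = src (arrow w) by [].
by apply: val_inj; rewrite /= (normP _) // (subsetP (normG _)).
Qed.

End NonextendableBiset.

(** * Minimality *)

Section Embeddings.
Variable S : finGroupType.
Implicit Types (W X Y : biset S).
Local Notation G := [set: S * S].

Lemma bact_eq W (w : W) (u v : S * S) :
  (bact W w u == bact W w v) = (u * v^-1 \in 'C[w | bact W]).
Proof.
apply/eqP/astab1P => [e|e]; first by rewrite actM e actK.
by rewrite -[u](mulgKV v) actM e.
Qed.

Lemma lract_bact W (w : W) a b : ract (lact a w) b = bact W w (a^-1, b).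
Proof. by rewrite /= /bact_fun /= invgK. Qed.

Lemma biset_morphismP X Y (h : X -> Y) :
  (forall x u, h (bact X x u) = bact Y (h x) u) -> biset_morphism h.
Proof. by move=> H a x b; rewrite !lract_bact H. Qed.

(** Each orbit of X is mapped to the orbit of a point of Y with the same stabilizer as a chosen
    representative. If two orbits had the same image, translating one representative would give it
    the stabilizer of the other, and the second hypothesis makes the orbits equal. *)
Lemma biset_embeds_stab X Y :
    (forall x : X, exists y : Y, 'C[x | bact X] = 'C[y | bact Y]) ->
    (forall x x' : X, 'C[x | bact X] = 'C[x' | bact X] ->
       x' \in orbit (bact X) G x) ->
  biset_embeds X Y.
Proof.
move=> /fin_all_exists[y hy] inj.
(* The choice depends only on the set [orbit (bact X) G x], so [rep] is constant on orbits; below,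
   [u x] carries [rep x] to x. *)
pose rep (x : X) := odflt x [pick r in orbit (bact X) G x].
have rep_orb x : rep x \in orbit (bact X) G x.
  by rewrite /rep; case: pickP => //= h; have := h x; rewrite orbit_refl.
have rep_eq x x' : x' \in orbit (bact X) G x -> rep x' = rep x.
  move=> /orbit_eqP e; rewrite /rep e; case: pickP => //= h.
  by have := h x; rewrite orbit_refl.
have /fin_all_exists[u hu] : forall x, exists u, bact X (rep x) u = x.
  by move=> x; have := rep_orb x; rewrite orbit_sym => /orbitP[v _ e]; exists v.
pose h x := bact Y (y (rep x)) (u x).
have hE x v : rep (bact X (rep x) v) = rep x.
  have xx : bact X (rep x) v \in orbit (bact X) G x.
    by apply: orbit_trans (rep_orb x); rewrite mem_orbit ?inE.
  exact: rep_eq.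
have stabE x v v' : bact X (rep x) v = bact X (rep x) v' ->
    bact Y (y (rep x)) v = bact Y (y (rep x)) v'.
  by move/eqP; rewrite bact_eq hy -bact_eq => /eqP.
exists h.
  apply: biset_morphismP => x v; rewrite /h.
  have e : rep (bact X x v) = rep x by rewrite -{1}(hu x) -actM hE.
  rewrite e -actM; apply: stabE; rewrite actM hu.
  by have := hu (bact X x v); rewrite e.
move=> x x' e; have er : rep x = rep x'.
  have e1 : y (rep x') = bact Y (y (rep x)) (u x * (u x')^-1).
    by rewrite actM -/(h x) e actK.
  have st : 'C[rep x' | bact X] = 'C[bact X (rep x) (u x * (u x')^-1) | bact X].
    by rewrite hy e1 !astab1_act hy.
  have := inj _ _ st => /rep_eq; rewrite hE => ->.
  exact: rep_eq.
rewrite -(hu x) -(hu x') -er; apply/eqP; rewrite bact_eq hy -bact_eq.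
by apply/eqP; rewrite -/(h x) e /h er.
Qed.

Lemma embeds_iso X Y : biset_embeds X Y -> #|Y| <= #|X| -> biset_iso X Y.
Proof.
case=> h hm hi le; exists h => //.
by apply: inj_card_bij.
Qed.

Lemma embeds_card X Y : biset_embeds X Y -> #|X| <= #|Y|.
Proof. by case=> h _ hi; apply: leq_card hi. Qed.

End Embeddings.

(** * Embedding the nonextendable isomorphisms in a centric characteristic biset *)

Section Minimality.
Variables (p : nat) (S : finGroupType) (F : fusion_system S) (L : linking_system F).
Implicit Types (P Q R : {group S}) (f : {ffun S -> S}).
Local Notation SG := [set: S]%G.
Local Notation J := (nonext_biset L).
Hypotheses (pp : prime p) (pS : p.-group [set: S]) (satF : saturated F p).
Variable V : biset S.
Hypothesis hV : centric_characteristic p F V.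

(** Otherwise every stabilizer has a proper source, and p |S| divides |V|, against the condition on
    the degree. *)
Lemma exists_stabT : exists v : V, exists2 f, f \in F SG SG & 'C[v | bact V] = tdiag SG f.
Proof.
case: hV => gV stV _ dV.
case: (boolP [exists v : V, exists f in F SG SG, 'C[v | bact V] == tdiag SG f]).
  by case/existsP=> v /exists_inP[f hf /eqP e]; exists v, f.
move=> /existsPn nx; case/negP: dV.
have dA : (p * #|[set: S]|)%N %| #|[set: V]|.
  apply: card_proper_points => // [a w b|w _]; first by rewrite !inE.
  have [Q [f [hf e]]] := gV w; exists Q, f; split=> //; first exact: fhom_injhom hf.
  rewrite properEneq subsetT andbT; apply: contraNneq (nx w) => /val_inj eQ.
  by rewrite eQ in hf e; apply/exists_inP; exists f => //; apply/eqP.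
apply/negPn/negP=> /(degree_setC (A := set0)); rewrite setC0 cards0 div0n dvdn0.
by case/(_ dA).
Qed.

(** A point fixed by (S, f0) yields, by stability, one fixed by (S, incl), hence by (P, incl);
    stability for P then yields one fixed by (P, f). *)
Lemma centric_char_fixed P f : centric F P -> f \in F P SG ->
  exists v : V, tdiag P f \subset 'C[v | bact V].
Proof.
move=> cP hf; case: hV => _ _ fV _; have [v [f0 hf0 e0]] := exists_stabT.
have i1 Q : hincl Q \in F Q SG by apply: fhom_codomT (fhom_incl F (subxx Q)).
apply/nfix_gt0; rewrite (fV P f cP hf).1.
have : 0 < nfix V SG f0 by apply/nfix_gt0; exists v; rewrite e0.
rewrite (fV SG f0 (centricT F) hf0).1 => /nfix_gt0[w hw].
apply/nfix_gt0; exists w; apply: subset_trans hw.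
rewrite (tdiag_sub (fhom_injhom (i1 P)) (fhom_injhom (i1 SG))) subsetT /=.
by apply/eqP/ffunP=> x; rewrite !ffunE inE.
Qed.

Lemma nonext_embeds : biset_embeds J V.
Proof.
apply: biset_embeds_stab => [w|]; last exact: (nonext_orbit satF).
have hw := arrow_fhom w.
have [v hv] := centric_char_fixed (src_obj (arrow w)) hw.
exists v; rewrite (nonext_stab satF).
case: hV => gV _ _ _; have [R [g [hg ev]]] := gV v.
move: hv; rewrite ev (tdiag_sub (fhom_injhom hw) (fhom_injhom hg)).
(* N_R(P) lies in N_psi = P for the source P of w, and normalizers grow, so R = P. *)
case/andP=> wR /eqP eg; have := sub_Nphi wR hw hg eg.
rewrite (arrow_Nphi satF) => /(pgroup_norm_eq pS wR) eR.
by rewrite -eg eR (hrestr_id (fhom_injhom hg)).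
Qed.

End Minimality.

(** * Stable completions *)

Section FullyNormalized.
Variables (p : nat) (S : finGroupType) (F : fusion_system S).
Implicit Types (P Q R : {group S}) (f : {ffun S -> S}) (a b : {perm S}).
Local Notation SG := [set: S]%G.
Hypotheses (pS : p.-group [set: S]) (satF : saturated F p).

Lemma exists_fully_normalized Q : exists2 P, fisomorphic F Q P & fully_normalized F P.
Proof.
have [P QP mx] := arg_maxnP (fun P : {group S} => #|'N(P)|) (fiso_refl F Q).
exists P => //; apply/forallP=> R; apply/implyP=> PR.
exact/mx/(fiso_trans QP).
Qed.

Section Conjugating.
Variables (R P : {group S}) (c : {ffun S -> S}).
Hypothesis isoc : c \in isos F R P.

(** This is the subgroup c Aut_S(R) c^-1 of Aut_F(P), described pointwise because c is a function on
    S and not a permutation. *)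
Definition transported_auts : {set {perm S}} :=
  [set a in AutF F P | [exists n in 'N(R), [forall y in R, a (c y) == c (y ^ n)]]].

Lemma transported_autsP a : reflect
  (a \in AutF F P /\ exists2 n, n \in 'N(R) & {in R, forall y, a (c y) = c (y ^ n)})
  (a \in transported_auts).
Proof.
have -> : (a \in transported_auts) = (a \in AutF F P) &&
    [exists n in 'N(R), [forall y in R, a (c y) == c (y ^ n)]] by exact: in_set.
apply: (iffP andP) => -[Aa].
  by case/exists_inP=> n Nn /forall_inP h; split=> //; exists n => // y /h/eqP.
case=> n Nn h; split=> //; apply/exists_inP; exists n => //.
by apply/forall_inP=> y /h/eqP.
Qed.

Lemma transported_auts_group_set : group_set transported_auts.
Proof.
apply/group_setP; split.
  apply/transported_autsP; split; first exact: (group1 (AutF_group F P)).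
  by exists 1; rewrite ?group1 // => y _; rewrite perm1 conjg1.
move=> a b /transported_autsP[Aa [n Nn ha]] /transported_autsP[Ab [m Nm hb]].
apply/transported_autsP; split; first exact: (groupM (G := AutF_group F P)).
exists (n * m) => [|y Ry]; first exact: groupM.
by rewrite permM ha // hb ?memJ_norm // conjgM.
Qed.

Canonical transported_auts_group := Group transported_auts_group_set.

(** Powers of a are transported from powers of n, so the order of a divides that of n. By Cauchy, a
    prime dividing the order of the group therefore divides |S|. *)
Lemma transported_auts_pgroup : p.-group transported_auts.
Proof.
apply/pgroupP=> q qq /(Cauchy qq)[a /transported_autsP[/AutFP[Aa _] [n Nn ha]] oa].
have ak k y : y \in R -> (a ^+ k) (c y) = c (y ^ (n ^+ k)).
  elim: k y => [|k IHk] y Ry; first by rewrite perm1 conjg1.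
  by rewrite expgS permM ha // IHk ?memJ_norm // -conjgM -expgS.
have a1 : a ^+ #[n] = 1.
  apply: (eq_Aut (groupX _ Aa) (group1 _)) => z.
  rewrite -(isos_im isoc) => /imsetP[y Ry ->].
  by rewrite ak // expg_order conjg1 perm1.
have qn : q %| #[n] by rewrite -oa order_dvdn a1.
apply: (pgroupP pS) => //; apply: dvdn_trans qn _.
by rewrite order_dvdG ?inE.
Qed.

Lemma exists_transported n : n \in 'N(R) ->
  exists2 a, a \in transported_auts & {in R, forall y, a (c y) = c (y ^ n)}.
Proof.
move=> Nn; have [d [isod e1 e2]] := isos_inv isoc.
have hn : hconj R n^-1 \in F R R.
  by apply: fhom_conj; rewrite inE invgK (normP Nn).
have hf := fhom_comp (fhom_comp (isos_fhom isod) hn) (isos_fhom isoc).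
have [a Aa ea] := AutF_of_fhom hf.
have E : {in R, forall y, a (c y) = c (y ^ n)}.
  move=> y Ry; rewrite ea ?(injhom_sub (isos_injhom isoc)) //.
  by rewrite !ffunE e1 // Ry invgK.
by exists a => //; apply/transported_autsP; split=> //; exists n.
Qed.

(** Aut_S(P) is Sylow in Aut_F(P), so some x conjugates c Aut_S(R) c^-1 into it. After replacing c
    by x o c, every element of N(R) satisfies the condition of [Nphi], and the extension axiom
    applies. Only the image of c survives this change. *)
Lemma fully_normalized_extension : fully_normalized F P ->
  exists2 b, b \in F 'N(R)%G SG & b @: R = P.
Proof.
move=> fnP; have [fcP sylP] := satF.1 P fnP.
have sTA : transported_auts_group \subset AutF_group F P.
  by apply/subsetP=> a /transported_autsP[].
have [x Ax sTx] := Sylow_Jsub (G := AutF_group F P)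
  (P := [group of AutS P]) sylP sTA transported_auts_pgroup.
have [Aux hx] := AutFP _ _ _ Ax.
pose f := hcomp (hrestr P (finfun x)) c.
have fE y : y \in R -> f y = x (c y).
  by move=> Ry; rewrite !ffunE (injhom_sub (isos_injhom isoc) Ry).
have hf : f \in F R P by apply: fhom_comp (isos_fhom isoc) hx.
have fR : f @: R = P.
  apply/eqP; rewrite eqEcard (card_injhom (fhom_injhom hf)).
  rewrite (fiso_card (fiso_isos isoc)) leqnn andbT.
  by case/injhomP: (fhom_injhom hf).
have NR : 'N(R) \subset Nphi R f.
  apply/subsetP=> n Nn; rewrite in_Nphi Nn /= fR.
  have NnV : n^-1 \in 'N(R) by rewrite groupV.
  have [a Ta ea] := exists_transported NnV.
  have := subsetP sTx (a ^ x); rewrite memJ_conjg => /(_ Ta) /morphimP[h _ Nh eh].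
  apply/exists_inP; exists h^-1; rewrite ?groupV //.
  apply/forall_inP=> y Ry; have cy := injhom_sub (isos_injhom isoc) Ry.
  rewrite !fE ?memJ_norm // -ea // invgK -permJ eh.
  by rewrite norm_conj_autE // (Aut_closed Aux).
have [b hb eb] := satF.2 R P f (fhom_codomT hf) fR fcP.
have RN : R \subset 'N(R) := normG R.
exists (hrestr 'N(R) b); first exact: (@fhom_restr _ _ _ _ 'N(R)%G _ NR hb).
rewrite -fR; apply: eq_in_imset => y Ry.
by rewrite ffunE (subsetP RN) // eb.
Qed.

End Conjugating.
End FullyNormalized.

(** * Burnside congruences for fixed points *)

Section FixedPointCount.
Variables (S : finGroupType) (X : biset S).
Local Notation G := [set: S * S].
Local Notation nf D := #|'Fix_(bact X)(D)|.

Lemma card_afixJ (D : {set S * S}) u : nf (D :^ u) = nf D.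
Proof.
suff -> : 'Fix_(bact X)(D :^ u) = (bact X)^~ u @: 'Fix_(bact X)(D).
  by rewrite card_imset //; apply: act_inj.
apply/setP=> w; apply/idP/imsetP=> [Fw|[v Fv ->]].
  exists (bact X w u^-1); last by rewrite actKV.
  move: Fw; rewrite !mem_fix astab1_act => h.
  by rewrite -(conjSg _ _ u) -conjsgM mulVg conjsg1.
by move: Fv; rewrite !mem_fix astab1_act conjSg.
Qed.

(** N acts on the points fixed by H, and u fixes among them those fixed by [u |: H]; the sum is |N|
    times the number of orbits. *)
Lemma burnside_mod (N : {group S * S}) (H : {set S * S}) : N \subset 'N(H) ->
  #|N| %| \sum_(u in N) nf (u |: H).
Proof.
move=> NH; have act : [acts N, on 'Fix_(bact X)(H) | bact X].
  apply/actsP=> u Nu w; rewrite !mem_fix astab1_act.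
  by rewrite -{1}(normP (subsetP NH u Nu)) conjSg.
suff <- : \sum_(u in N) #|'Fix_('Fix_(bact X)(H) | bact X)[u]| =
    \sum_(u in N) nf (u |: H) by rewrite (Frobenius_Cauchy act) dvdn_mull.
by apply: eq_bigr => u _; rewrite afixU setIC.
Qed.

(** In the Burnside sums for N and for its image, the terms outside H agree by hypothesis, and each
    of the |H| terms inside H counts the points fixed by H, respectively by its image. *)
Lemma card_fix_congruence (N H : {group S * S}) (mu : {morphism N >-> S * S}) :
    H <| N -> 'injm mu ->
    {in N, forall u, u \notin H -> nf (u |: H) = nf (mu u |: mu @* H)} ->
  nf H * #|H| = nf (mu @* H) * #|H| %[mod #|N|].
Proof.
move=> /andP[HN NH] inj E.
have split_sum (f : S * S -> nat) :
    \sum_(u in N) f u = (\sum_(u in H) f u + \sum_(u in N :\: H) f u)%N.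
  rewrite (bigID (mem H)) /=; congr (_ + _)%N; apply: eq_bigl => u.
    by rewrite andbC; case: (boolP (u \in H)) => //= /(subsetP HN).
  by rewrite inE andbC.
have d1 := burnside_mod NH.
have d2 : #|mu @* N| %| \sum_(u in mu @* N) nf (u |: mu @* H).
  by apply: burnside_mod; rewrite (subset_trans (morphimS _ NH)) // morphim_norm.
rewrite card_injm // morphimEdom big_imset /= in d2; last first.
  by move=> u v Nu Nv; apply: (injmP inj).
rewrite split_sum in d1; rewrite split_sum in d2.
have e1 : \sum_(u in H) nf (u |: H) = (nf H * #|H|)%N.
  rewrite mulnC -sum_nat_const; apply: eq_bigr => u Hu.
  by rewrite (setUidPr _) // sub1set.
have e2 : \sum_(u in H) nf (mu u |: mu @* H) = (nf (mu @* H) * #|H|)%N.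
  rewrite mulnC -sum_nat_const; apply: eq_bigr => u Hu.
  by rewrite (setUidPr _) // sub1set mem_morphim // (subsetP HN).
have e3 : \sum_(u in N :\: H) nf (u |: H) = \sum_(u in N :\: H) nf (mu u |: mu @* H).
  by apply: eq_bigr => u /setDP[Nu nHu]; apply: E.
rewrite e1 e3 in d1; rewrite e2 in d2.
apply/eqP; rewrite -(eqn_modDr (\sum_(u in N :\: H) nf (mu u |: mu @* H))).
by rewrite (eqP d1) (eqP d2).
Qed.

End FixedPointCount.

(** * Transport of subgroups of S x S by pairs of isomorphisms *)

Section Transport.
Variables (S : finGroupType) (F : fusion_system S).
Implicit Types (P Q R A B : {group S}) (f g : {ffun S -> S}).
Implicit Types (K : {group S * S}) (u : S * S).
Local Notation SG := [set: S]%G.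
Definition pair_map f g u : S * S := (f u.1, g u.2).

Lemma mem_setXP (A B : {set S}) u :
  reflect (u.1 \in B /\ u.2 \in A) (u \in setX B A).
Proof. by case: u => b a; apply: setXP. Qed.

Lemma pair_map_group_set A A' B B' f g K :
    g \in injhom A A' -> f \in injhom B B' -> K \subset setX B A ->
  group_set (pair_map f g @: K).
Proof.
move=> hg hf /subsetP KBA; apply/group_setP; split.
  by apply/imsetP; exists 1; rewrite // /pair_map /= (injhom1 hf) (injhom1 hg).
move=> _ _ /imsetP[u Ku ->] /imsetP[v Kv ->]; apply/imsetP.
exists (u * v); first exact: groupM.
case/mem_setXP: (KBA _ Ku) => u1 u2; case/mem_setXP: (KBA _ Kv) => v1 v2.
by rewrite /pair_map /= (injhomM hf) // (injhomM hg).
Qed.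

(** The graph of k is carried to the graph of f o k o g^-1. *)
Lemma pair_map_tdiag Q Q' B B' f g k : k \in F Q SG -> g \in isos F Q Q' ->
    f \in F B B' -> k @: Q \subset B ->
  exists2 k', k' \in F Q' SG & pair_map f g @: tdiag Q k = tdiag Q' k'.
Proof.
move=> hk hg hf kB; have [d [hd e1 e2]] := isos_inv hg.
exists (hcomp f (hcomp k d)).
  apply: fhom_codomT (fhom_comp (fhom_comp (isos_fhom hd) (fhom_codom hk kB)) hf).
apply/setP=> -[b a]; rewrite mem_tdiag; apply/imsetP/andP.
  case=> u /tdiagP[Qu eu] [-> ->]; rewrite (injhom_sub (isos_injhom hg) Qu).
  by rewrite !ffunE e1 // eu.
case=> Qa /eqP ->; exists (k (d a), d a); last by rewrite /pair_map /= e2 // !ffunE.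
by rewrite mem_tdiag (injhom_sub (isos_injhom hd) Qa) eqxx.
Qed.

Lemma subgroup_tdiag K R f : f \in F R SG -> K \subset tdiag R f ->
  exists Q g, [/\ Q \subset R, g \in F Q SG & tdiag Q g = K].
Proof.
move=> hf /subsetP KR.
have gK : group_set [set u.2 | u in K].
  apply/group_setP; split; first by apply/imsetP; exists 1.
  move=> _ _ /imsetP[u Ku ->] /imsetP[v Kv ->].
  by apply/imsetP; exists (u * v); rewrite ?groupM.
have QR : Group gK \subset R.
  by apply/subsetP=> _ /imsetP[u /KR/tdiagP[Ru _] ->].
exists (Group gK), (hrestr (Group gK) f); split=> //; first exact: fhom_restr hf.
apply/setP=> u; apply/tdiagP/idP => [[/imsetP[v Kv e]]|Ku].
  have /tdiagP[_ ev] := KR v Kv; rewrite e ffunE -e (_ : u.2 \in _); last first.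
    by apply/imsetP; exists v.
  by rewrite e -ev => e1; rewrite [u]surjective_pairing e e1 -surjective_pairing.
have Gu : u.2 \in Group gK by apply/imsetP; exists u.
by have /tdiagP[_ ->] := KR u Ku; rewrite ffunE Gu.
Qed.

Lemma tdiagJ Q f u : f \in F Q SG ->
  exists2 g, g \in F (Q :^ u.2)%G SG & tdiag Q f :^ u = tdiag (Q :^ u.2) g.
Proof.
move=> hf; have h2 := isos_conj F Q u.2^-1.
have eQ : (Q :^ u.2^-1^-1)%G = (Q :^ u.2)%G by apply: val_inj; rewrite /= invgK.
rewrite eQ in h2.
have h1 : hconj SG u.1^-1 \in F SG SG by apply: fhom_conj; rewrite inE subsetT.
have [g hg e] := pair_map_tdiag hf h2 h1 (subsetT _).
exists g => //; rewrite -e; apply: eq_in_imset => v /tdiagP[Qv _].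
by rewrite /pair_map !ffunE Qv inE !invgK.
Qed.

(** Stability restricted to orders above n, the invariant of the descending construction. It relates
    all morphisms of [F] out of isomorphic sources, since composing with isomorphisms of [F] reduces
    each of them to an inclusion. *)
Definition stable_above (X : biset S) n : Prop := forall P Q f g,
  n < #|P| -> fisomorphic F P Q -> f \in F P SG -> g \in F Q SG ->
  nfix X P f = nfix X Q g.

Variable X : biset S.
Hypothesis gX : fgenerated F X.
Local Notation nf D := #|'Fix_(bact X)(D)|.

Lemma fix_tdiag K : 0 < nf K -> exists P f, f \in F P SG /\ tdiag P f = K.
Proof.
rewrite card_gt0 => /set0Pn[w]; rewrite mem_fix.
have [R [f [hf ->]]] := gX w => /(subgroup_tdiag hf)[Q [g [_ hg e]]].
by exists Q, g.
Qed.

Lemma nfix_gt0_fhom P f : f \in injhom P SG -> 0 < nfix X P f -> f \in F P SG.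
Proof.
move=> hf; pose K := Group (tdiag_group_set hf).
case/(@fix_tdiag K)=> Q [g [hg /= e]].
by have [<- <-] := tdiag_inj (fhom_injhom hg) hf e.
Qed.

Variable n : nat.
Hypothesis stX : stable_above X n.

Lemma card_fix_pair_map_gt0 A A' B B' f g K :
    g \in isos F A A' -> f \in isos F B B' -> K \subset setX B A ->
  n < #|K| -> 0 < nf K -> nf (pair_map f g @: K) = nf K.
Proof.
move=> hg hf KBA nK /fix_tdiag[P [k [hk eK]]].
rewrite -eK in KBA nK *; rewrite card_tdiag in nK.
have PA : P \subset A.
  apply/subsetP=> x Px.
  by case/mem_setXP: (subsetP KBA (k x, x) (imset_f (fun a => (k a, a)) Px)).
have kB : k @: P \subset B.
  apply/subsetP=> _ /imsetP[x Px ->].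
  by case/mem_setXP: (subsetP KBA (k x, x) (imset_f (fun a => (k a, a)) Px)).
have hgP := fhom_restr PA (isos_fhom hg).
have [P' [_ _ isoP]] := fhom_im hgP.
have [k' hk' ek'] := pair_map_tdiag hk isoP (isos_fhom hf) kB.
have -> : pair_map f g @: tdiag P k = tdiag P' k'.
  rewrite -ek'; apply: eq_in_imset => v /tdiagP[Pv _].
  by rewrite /pair_map ffunE Pv.
by symmetry; apply: stX => //; apply: fiso_isos isoP.
Qed.

(** If K has a fixed point it is the graph of a morphism of [F], and stability applies. If it has
    none, neither has its image: the inverse isomorphisms would carry a positive count back to K. *)
Lemma card_fix_pair_map A A' B B' f g K :
    g \in isos F A A' -> f \in isos F B B' -> K \subset setX B A ->
  n < #|K| -> nf (pair_map f g @: K) = nf K.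
Proof.
move=> hg hf KBA nK; have [K0|] := posnP (nf K); last first.
  exact: (card_fix_pair_map_gt0 hg hf).
have [e0|] := posnP (nf (pair_map f g @: K)); first by rewrite e0 K0.
have hK := pair_map_group_set (isos_injhom hg) (isos_injhom hf) KBA.
have [g' [hg' cg _]] := isos_inv hg; have [f' [hf' cf _]] := isos_inv hf.
have KE u : u \in K -> u.1 \in B /\ u.2 \in A.
  by move/(subsetP KBA)/mem_setXP.
have eK : pair_map f' g' @: (pair_map f g @: K) = K.
  rewrite -imset_comp; rewrite -[RHS]imset_id; apply: eq_in_imset => u /KE[u1 u2].
  by rewrite /= /pair_map /= cf // cg // -surjective_pairing.
have cK : #|pair_map f g @: K| = #|K|.
  apply: card_in_imset => u v /KE[u1 u2] /KE[v1 v2].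
  case=> /(can_in_inj cf) e1 /(can_in_inj cg) e2.
  by rewrite [u]surjective_pairing e1 // e2 // -surjective_pairing.
move=> pos; symmetry; rewrite -{1}eK.
apply: (@card_fix_pair_map_gt0 A' A B' B f' g' (Group hK)) => //; last by rewrite /= cK.
apply/subsetP=> _ /imsetP[u /KE[u1 u2] ->]; apply/mem_setXP; split.
  exact: injhom_sub (isos_injhom hf) u1.
exact: injhom_sub (isos_injhom hg) u2.
Qed.

End Transport.

(** * The congruence between (Q, f) and a fully normalized representative *)

Section NfixCongruence.
Variables (p : nat) (S : finGroupType) (F : fusion_system S).
Implicit Types (P Q R A B : {group S}) (f g : {ffun S -> S}).
Implicit Types (u : S * S).
Local Notation SG := [set: S]%G.
Hypotheses (pS : p.-group [set: S]) (satF : saturated F p).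

Lemma norm_tdiag Q f u : f \in injhom Q SG -> u \in 'N(tdiag Q f) ->
  [/\ u.2 \in 'N(Q), u.1 \in 'N(f @: Q) & {in Q, forall x, f (x ^ u.2) = f x ^ u.1}].
Proof.
move=> hf Nu.
have key x : x \in Q -> x ^ u.2 \in Q /\ f (x ^ u.2) = f x ^ u.1.
  move=> Qx; have Hx : (f x, x) \in tdiag Q f by rewrite mem_tdiag Qx eqxx.
  move: Hx; rewrite -(memJ_norm _ Nu) => /tdiagP[h2 h1].
  by split; [exact: h2 | symmetry; exact: h1].
split.
- by rewrite inE; apply/subsetP=> _ /imsetP[x /key[Qx _] ->].
- rewrite inE; apply/subsetP=> _ /imsetP[_ /imsetP[x Qx ->] ->].
  by have [Qxu <-] := key x Qx; apply: imset_f.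
by move=> x /key[].
Qed.

(* An extension b of f(Q) -> P to N_S(f(Q)), followed by an extension a of
   b o f, makes (b, a) embed N((Q, f)) in S x S, taking (Q, f) to (P, incl);
   Burnside's lemma then compares the two sets of fixed points. *)
Lemma nfix_congruence (X : biset S) Q P f : fgenerated F X ->
    stable_above F X #|Q| -> fully_normalized F P -> fisomorphic F Q P ->
    f \in F Q SG ->
  nfix X Q f * #|Q| = nfix X P (hincl P) * #|Q| %[mod #|'N(tdiag Q f)|].
Proof.
move=> gX stX fnP QP hf; have jf := fhom_injhom hf.
have [R [eR _ isof]] := fhom_im hf.
have RP : fisomorphic F R P.
  by apply: fiso_trans QP; rewrite fiso_sym; apply: fiso_isos isof.
case/existsP: RP => c isoc.
have [b hb ebR] := fully_normalized_extension pS satF isoc fnP.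
have jb := fhom_injhom hb.
have RN := subsetP (normG R).
have fQ x : x \in Q -> f x \in R by apply: injhom_sub (isos_injhom isof).
pose f0 := hcomp (hrestr R b) f.
have f0E x : x \in Q -> f0 x = b (f x) by move=> Qx; rewrite !ffunE fQ.
have hf0 : f0 \in F Q SG.
  by apply: fhom_comp (isos_fhom isof) _; apply: fhom_restr hb; apply: normG.
have ef0 : f0 @: Q = P.
  rewrite -ebR -eR -imset_comp; apply: eq_in_imset => x Qx.
  exact: f0E.
have [fcP _] := satF.1 P fnP.
have [a ha ea] := satF.2 Q P f0 hf0 ef0 fcP.
have ja := fhom_injhom ha.
set H := Group (tdiag_group_set jf).
pose N := 'N(H)%G.
(* If u normalizes (Q, f), then f turns conjugation by [u.2] on Q into conjugation by [u.1] on f(Q).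
   So [b u.1] witnesses that [u.2] lies in the domain of a, and (b, a) is defined on N. *)
have NE u : u \in N -> u.1 \in 'N(R) /\ u.2 \in Nphi Q f0.
  move=> Nu; have [u2 u1 _] := norm_tdiag jf Nu; rewrite eR in u1; split=> //.
  have NVu : u^-1 \in N by rewrite groupV.
  have [_ _ e] := norm_tdiag jf NVu; rewrite /= in e.
  rewrite in_Nphi u2; apply/exists_inP; exists (b u.1).
    rewrite ef0 -ebR inE; apply/subsetP=> _ /imsetP[_ /imsetP[y Ry ->] ->].
    by rewrite -(injhomJ jb (RN _ Ry) u1) imset_f // memJ_norm.
  apply/forall_inP=> x Qx; have Qx' : x ^ u.2^-1 \in Q by rewrite memJ_norm ?groupV.
  rewrite !f0E // e // (injhomJ jb (RN _ (fQ _ Qx))) ?groupV //.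
  by rewrite (injhomV jb).
have [A' [_ _ isoa]] := fhom_im ha; have [B' [_ _ isob]] := fhom_im hb.
have muM : {in N &, {morph pair_map b a : u v / u * v}}.
  move=> u v /NE[u1 u2] /NE[v1 v2].
  by rewrite /pair_map /= (injhomM jb) // (injhomM ja).
pose mu := Morphism muM.
have inj : 'injm mu.
  apply/injmP=> u v /NE[u1 u2] /NE[v1 v2] /= [e1 e2].
  rewrite [u]surjective_pairing (injhom_inj jb u1 v1 e1) (injhom_inj ja u2 v2 e2).
  by rewrite -surjective_pairing.
have HN : H \subset N := normG H.
have eH : mu @* H = tdiag P (hincl P).
  rewrite morphimEsub //; apply/setP=> -[y x]; rewrite mem_tdiag.
  apply/imsetP/andP => [[u /tdiagP[Qu eu]] [-> ->]|[Px /eqP->]].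
    have Pu : a u.2 \in P by rewrite ea // -ef0; apply: imset_f.
    by rewrite ffunE Pu eu -f0E // ea.
  rewrite ffunE Px; move: (Px); rewrite -ef0 => /imsetP[z Qz ->].
  exists (f z, z); first by rewrite mem_tdiag Qz eqxx.
  by rewrite /= /pair_map /= -f0E // ea.
have := @card_fix_congruence _ X N H mu; rewrite eH card_tdiag; apply=> //.
  by rewrite /normal HN subxx.
(* A set and the group it generates have the same fixed points. For u outside H this group has order
   greater than |Q|, the range in which stability is assumed. *)
move=> u Nu nHu; have uHN : u |: H \subset N by rewrite subUset sub1set Nu.
have KN : <<u |: H>> \subset N by rewrite gen_subG.
have FG D : #|'Fix_(bact X)(D)| = #|'Fix_(bact X)(<<D>>)| by rewrite afix_gen.
rewrite -eH FG [RHS]FG.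
have -> : <<mu u |: mu @* H>> = pair_map b a @: <<u |: H>>.
  rewrite -morphim_set1 // -morphimU -morphim_gen //.
  by rewrite morphimEsub.
symmetry; apply: (card_fix_pair_map gX stX isoa isob).
  by apply/subsetP=> v /(subsetP KN)/NE[v1 v2]; apply/mem_setXP.
rewrite -(card_tdiag Q f) proper_card // properE.
apply/andP; split; first by apply: subset_trans (subset_gen _); apply: subsetUr.
by apply: contra nHu => /subsetP; apply; apply: mem_gen; rewrite setU11.
Qed.

End NfixCongruence.

(** * Disjoint unions and the transitive bisets [Q, f] *)

Section BisetConstructions.
Variable S : finGroupType.
Implicit Types (W V : biset S) (P Q : {group S}) (f g : {ffun S -> S}).
Local Notation SG := [set: S]%G.

Definition empty_biset : biset S.
Proof.
by apply: (@Biset S void (fun _ => id) (fun w _ => w));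
  [case | move=> a b [] | case | case | move=> a [] | move=> a [] | move=> a []].
Defined.

Definition coprod_biset W V : biset S.
Proof.
apply: (@Biset S (W + V)%type
  (fun a w => match w with inl x => inl (lact a x) | inr y => inr (lact a y) end)
  (fun w a => match w with inl x => inl (ract x a) | inr y => inr (ract y a) end)).
- by case=> w; rewrite lact1.
- by move=> a b [] w; rewrite lactM.
- by case=> w; rewrite ract1.
- by move=> [] w a b; rewrite ractM.
- by move=> a [] w b; rewrite lractA.
- by move=> a [] w [] /lact_free.
- by move=> a [] w [] /ract_free.
Defined.

Lemma coprod_stab_l W V (w : W) :
  'C[inl w : coprod_biset W V | bact _] = 'C[w | bact W].
Proof.
by apply/setP=> u; rewrite !mem_stab; apply/eqP/eqP=> [[]|/= ->].
Qed.

Lemma coprod_stab_r W V (w : V) :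
  'C[inr w : coprod_biset W V | bact _] = 'C[w | bact V].
Proof.
by apply/setP=> u; rewrite !mem_stab; apply/eqP/eqP=> [[]|/= ->].
Qed.

Lemma nfix_coprod W V P f :
  nfix (coprod_biset W V) P f = (nfix W P f + nfix V P f)%N.
Proof.
rewrite /nfix -!sum1_card big_sumType /=; congr (_ + _)%N; apply: eq_bigl => w.
  by rewrite [RHS]mem_fix -(coprod_stab_l V w) -mem_fix.
by rewrite [RHS]mem_fix -(coprod_stab_r W w) -mem_fix.
Qed.

Fixpoint copies m W : biset S :=
  if m is k.+1 then coprod_biset W (copies k W) else empty_biset.

Lemma nfix_copies m W P f : nfix (copies m W) P f = (m * nfix W P f)%N.
Proof.
elim: m => [|m IHm] /=; last by rewrite nfix_coprod IHm mulSn.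
by rewrite mul0n; apply/eqP; rewrite -leqn0 leqNgt; apply/negP=> /nfix_gt0[[]].
Qed.

Section CosetBiset.
Variables (Q : {group S}) (f : {ffun S -> S}).
Hypothesis hf : f \in injhom Q SG.
Let H := Group (tdiag_group_set hf).
Let T := {X : {set S * S} | X \in rcosets H [set: S * S]}.

Lemma coset_act_proof (X : T) (u : S * S) : val X :* u \in rcosets H [set: S * S].
Proof.
have /rcosetsP[v _ ->] := valP X.
by apply/rcosetsP; exists (v * u); rewrite ?inE ?rcosetM.
Qed.

Let cact (X : T) u : T := 
  exist (fun Y => Y \in rcosets H [set: S * S]) (val X :* u) (coset_act_proof X u).

Lemma coset_act1 X u : u = 1 -> cact X u = X.
Proof. by move->; apply: val_inj; rewrite /= rcoset1. Qed.

Lemma coset_actM X u v : cact (cact X u) v = cact X (u * v).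
Proof. by apply: val_inj; rewrite /= rcosetM. Qed.

Lemma coset_act_fix X u : cact X u = X -> exists v, u \in H :^ v.
Proof.
move=> /(congr1 val) /=; have /rcosetsP[v _ ->] := valP X.
rewrite -rcosetM => /rcoset_eqP; rewrite mem_rcoset => h.
by exists v; rewrite mem_conjg conjgE invgK mulgA.
Qed.

(** With the next lemma: conjugates of the graph of an injection meet both factors of S x S
    trivially, which makes the two actions on its cosets free. *)
Lemma tdiag_conj_l b w : (b, 1) ^ w \in tdiag Q f -> b = 1.
Proof.
case/tdiagP=> _ e; have {e} : b ^ w.1 = f (1 ^ w.2) := e.
by rewrite conj1g (injhom1 hf) => /eqP; rewrite conjg_eq1 => /eqP.
Qed.

Lemma tdiag_conj_r a w : (1, a) ^ w \in tdiag Q f -> a = 1.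
Proof.
case/tdiagP=> h e; have {e} : 1 ^ w.1 = f (a ^ w.2) := e.
have {h} h : a ^ w.2 \in Q := h.
by rewrite conj1g => /esym/eqP; rewrite (injhom_eq1 hf h) conjg_eq1 => /eqP.
Qed.

(** A model of [Q, f] on right cosets, because [bact] is a right action; for the same reason a acts
    on the left through a^-1. *)
Definition coset_biset : biset S.
Proof.
apply: (@Biset S T (fun a X => cact X (a^-1, 1)) (fun X a => cact X (1, a))).
- by move=> X; apply: coset_act1; rewrite invg1.
- move=> a b X; rewrite coset_actM; congr cact.
  by rewrite invMg; congr pair; rewrite mulg1.
- by move=> X; apply: coset_act1.
- by move=> X a b; rewrite coset_actM; congr cact; congr pair; rewrite mulg1.
- move=> a X b; rewrite !coset_actM; congr cact.
  by congr pair; rewrite ?mulg1 ?mul1g.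
- move=> a X /coset_act_fix[v]; rewrite mem_conjg => /tdiag_conj_l/eqP.
  by rewrite invg_eq1 => /eqP.
by move=> a X /coset_act_fix[v]; rewrite mem_conjg => /tdiag_conj_r.
Defined.

Lemma coset_bactE (X : coset_biset) u : val (bact coset_biset X u) = val X :* u.
Proof.
rewrite /= -rcosetM invgK; congr (_ :* _); rewrite [u in RHS]surjective_pairing.
by congr pair; rewrite ?mulg1 ?mul1g.
Qed.

Lemma coset_stab (X : coset_biset) v : val X = H :* v ->
  'C[X | bact coset_biset] = H :^ v.
Proof.
move=> eX; apply/setP=> u; rewrite mem_conjg conjgE invgK.
apply/astab1P/idP=> [/(congr1 val)|h].
  rewrite coset_bactE eX -rcosetM => /rcoset_eqP.
  by rewrite mem_rcoset mulgA.
apply: val_inj; rewrite coset_bactE eX -rcosetM; apply/rcoset_eqP.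
by rewrite mem_rcoset -mulgA.
Qed.

Lemma coset_stabJ (X : coset_biset) :
  exists v, 'C[X | bact coset_biset] = tdiag Q f :^ v.
Proof.
have /rcosetsP[v _ /coset_stab e] := valP X; by exists v.
Qed.

(** The coset H v has stabilizer H^v, so H fixes exactly the cosets contained in N(H). *)
Lemma nfix_coset : (nfix coset_biset Q f * #|Q|)%N = #|'N(tdiag Q f)|.
Proof.
rewrite -(card_tdiag Q f) -(Lagrange (normG H)) mulnC; congr (_ * _)%N.
rewrite -[LHS](card_imset (f := val : T -> _) _ val_inj); apply: eq_card => A.
apply/imsetP/rcosetsP => [[X]|[v Nv ->]].
  rewrite [_ \in _](@mem_fix _ coset_biset X) => HX ->; have /rcosetsP[v _ eX] := valP X.
  exists v => //; rewrite (coset_stab eX) in HX.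
  rewrite -groupV inE -(conjSg _ _ v) -conjsgM mulVg conjsg1.
  exact: HX.
have AH : H :* v \in rcosets H [set: S * S] by apply/rcosetsP; exists v; rewrite ?inE.
pose X : coset_biset := exist (fun Y => Y \in rcosets H [set: S * S]) (H :* v) AH.
exists X => //.
rewrite [_ \in _](@mem_fix _ coset_biset).
by rewrite (@coset_stab X v) // (normP Nv).
Qed.

End CosetBiset.
End BisetConstructions.

(** * Completion to a stable biset by noncentric orbits *)

Section Completion.
Variables (p : nat) (S : finGroupType) (F : fusion_system S).
Implicit Types (P Q R : {group S}) (f g : {ffun S -> S}) (Y Z : biset S).
Local Notation SG := [set: S]%G.
Hypotheses (pS : p.-group [set: S]) (satF : saturated F p).

Definition noncentric_biset Y : Prop := forall y : Y, exists Q f,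
  [/\ ~~ centric F Q, f \in F Q SG & 'C[y | bact Y] = tdiag Q f].

Lemma noncentric_coprod Y Z : noncentric_biset Y -> noncentric_biset Z ->
  noncentric_biset (coprod_biset Y Z).
Proof.
move=> nY nZ [y|z].
  have [Q [f [cQ hf e]]] := nY y; exists Q, f; split=> //.
  by rewrite -e; apply: coprod_stab_l.
have [Q [f [cQ hf e]]] := nZ z; exists Q, f; split=> //.
by rewrite -e; apply: coprod_stab_r.
Qed.

Lemma noncentric_copies m Y : noncentric_biset Y -> noncentric_biset (copies m Y).
Proof. by move=> nY; elim: m => [|m IHm]; [case | apply: noncentric_coprod]. Qed.

Lemma noncentric_coset Q f (jf : f \in injhom Q SG) :
  f \in F Q SG -> ~~ centric F Q -> noncentric_biset (coset_biset jf).
Proof.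
move=> hf cQ X; have [v eX] := coset_stabJ X.
have [g hg eg] := tdiagJ v hf; exists (Q :^ v.2)%G, g.
rewrite eX; split; [|exact: hg|exact: eg].
apply/negP=> c; case/negP: cQ; apply: centric_fiso c.
by rewrite fiso_sym; apply: fisoJ.
Qed.

Lemma noncentric_fgenerated Y : noncentric_biset Y -> fgenerated F Y.
Proof. by move=> nY y; have [Q [f [_ hf e]]] := nY y; exists Q, f. Qed.

Lemma coprod_fgenerated Y Z : fgenerated F Y -> fgenerated F Z ->
  fgenerated F (coprod_biset Y Z).
Proof.
move=> gY gZ [y|z].
  have [Q [f [hf e]]] := gY y; exists Q, f; split=> //.
  by rewrite -e; apply: coprod_stab_l.
have [Q [f [hf e]]] := gZ z; exists Q, f; split=> //.
by rewrite -e; apply: coprod_stab_r.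
Qed.

Lemma nfix_noncentric Y P f : noncentric_biset Y -> centric F P -> f \in F P SG ->
  nfix Y P f = 0.
Proof.
move=> nY cP hf; apply/eqP; rewrite -leqn0 leqNgt; apply/negP=> /nfix_gt0[y].
have [Q [g [cQ hg ->]]] := nY y.
rewrite (tdiag_sub (fhom_injhom hf) (fhom_injhom hg)) => /andP[PQ _].
by case/negP: cQ; apply: centric_over cP PQ.
Qed.

Lemma nfix_conj Y P Q f g u : tdiag P f = tdiag Q g :^ u ->
  nfix Y P f = nfix Y Q g.
Proof. by rewrite /nfix => ->; apply: card_afixJ. Qed.

Lemma nfix_coset_gt0 Q f (hf : f \in injhom Q SG) P g :
  0 < nfix (coset_biset hf) P g ->
  exists u, tdiag P g \subset tdiag Q f :^ u.
Proof.
by case/nfix_gt0=> X; have [v ->] := coset_stabJ X; exists v.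
Qed.

Variable J : biset S.
Hypothesis gJ : fgenerated F J.
Hypothesis stJ : forall P Q f g, centric F P -> fisomorphic F P Q ->
  f \in F P SG -> g \in F Q SG -> nfix J P f = nfix J Q g.

(** The predicate depends only on the isomorphism class of Q, so isomorphic subgroups receive the
    same representative and the target built from it is a class function. *)
Let rep Q := odflt Q [pick P | fisomorphic F Q P && fully_normalized F P].

Lemma repP Q : fisomorphic F Q (rep Q) /\ fully_normalized F (rep Q).
Proof.
rewrite /rep; case: pickP => [P /andP[]//|h].
by have [P QP fnP] := exists_fully_normalized F Q; have := h P; rewrite QP fnP.
Qed.

Lemma rep_eq P Q : fisomorphic F P Q -> rep P = rep Q.
Proof.
move=> PQ; rewrite /rep.
rewrite (@eq_pick _ _ [pred R | fisomorphic F Q R && fully_normalized F R]).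
  case: pickP => //= h; have [R QR fnR] := exists_fully_normalized F Q.
  by have := h R; rewrite /= QR fnR.
move=> R /=; congr (_ && _); apply/idP/idP=> h; last exact: fiso_trans h.
by rewrite fiso_sym in PQ; exact: fiso_trans h.
Qed.

Section Step.
Variables (n : nat) (Y : biset S).
Hypotheses (nY : noncentric_biset Y) (stY : stable_above F (coprod_biset J Y) n).
Let X := coprod_biset J Y.
(* The common number of fixed points to be reached on the class of Q: large
   enough, and in the residue class imposed by [nfix_congruence]. *)
Let M Q := (nfix X (rep Q) (hincl (rep Q)) + #|X| * #|[set: S * S]|)%N.

Lemma target_eq P Q : fisomorphic F P Q -> M P = M Q.
Proof. by move=> PQ; rewrite /M (rep_eq PQ). Qed.

Lemma nfix_le_target Q f : nfix X Q f <= M Q.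
Proof.
apply: leq_trans (leq_addl _ _); apply: leq_trans (max_card _) _.
by rewrite leq_pmulr ?cardG_gt0.
Qed.

(** The summand of [M] that makes it large is a multiple of |S x S|, hence of |N(Q, f)|, and does
    not disturb the congruence. *)
Lemma target_mod Q f : #|Q| = n -> f \in F Q SG ->
  nfix X Q f * n = M Q * n %[mod #|'N(tdiag Q f)|].
Proof.
move=> eQ hf; have [Qr fnr] := repP Q.
have gX : fgenerated F X := coprod_fgenerated gJ (noncentric_fgenerated nY).
have stQ : stable_above F X #|Q| by rewrite eQ.
have := nfix_congruence pS satF gX stQ fnr Qr hf; rewrite eQ => ->.
have dG : #|'N(tdiag Q f)| %| #|X| * #|[set: S * S]| * n.
  by rewrite dvdn_mulr // dvdn_mull //; exact: cardSg (subsetT 'N(tdiag Q f)%G).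
by rewrite /M mulnDl -modnDmr (eqP dG) addn0.
Qed.

Let bad Z := [set u : {group S} * {ffun S -> S} |
  [&& #|u.1| == n, ~~ centric F u.1, u.2 \in F u.1 SG
    & nfix (coprod_biset J Z) u.1 u.2 != M u.1]].

(** At order n, pairs below their target are repaired by adding copies of [Q, f], by induction on
    the number of such pairs. Orders above n are unaffected, since a stabilizer in [Q, f] has order
    n. *)
Lemma completion_step : exists2 Z, noncentric_biset Z &
  forall P Q f g, n <= #|P| -> fisomorphic F P Q -> f \in F P SG ->
    g \in F Q SG ->
  nfix (coprod_biset J Z) P f = nfix (coprod_biset J Z) Q g.
Proof.
suff [Z [nZ stZ Z0]] : exists Z, [/\ noncentric_biset Z,
    forall P f, n < #|P| -> f \in F P SG -> nfix (coprod_biset J Z) P f = nfix X P f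
  & bad Z = set0].
  exists Z => // P Q f g; rewrite leq_eqVlt => /orP[/eqP eP|nP] PQ hf hg; last first.
    by rewrite !stZ -?(fiso_card PQ) //; apply: stY.
  have [cP|cP] := boolP (centric F P).
    have cQ := centric_fiso PQ cP.
    by rewrite !nfix_coprod !(nfix_noncentric nZ) // (stJ cP PQ hf hg).
  have cQ : ~~ centric F Q.
    by apply: contra cP; apply: centric_fiso; rewrite fiso_sym.
  have good R h : #|R| = n -> ~~ centric F R -> h \in F R SG ->
      nfix (coprod_biset J Z) R h = M R.
    move=> eR cR hh; have := in_set0 (R, h); rewrite -Z0 inE /= eR eqxx cR hh /=.
    by move=> /negbT; rewrite negbK => /eqP.
  rewrite (good P f (esym eP) cP hf).
  rewrite (good Q g (etrans (esym (fiso_card PQ)) (esym eP)) cQ hg).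
  exact: target_eq.
(* The invariant keeps the bound and the congruence together: they say that the deficit is
   nonnegative and divisible by the contribution of one copy of [Q, f]. *)
suff main k Z : #|bad Z| <= k -> noncentric_biset Z ->
    (forall P f, n < #|P| -> f \in F P SG ->
       nfix (coprod_biset J Z) P f = nfix X P f) ->
    (forall Q f, #|Q| = n -> ~~ centric F Q -> f \in F Q SG ->
       nfix (coprod_biset J Z) Q f <= M Q /\
       nfix (coprod_biset J Z) Q f * n = M Q * n %[mod #|'N(tdiag Q f)|]) ->
    exists Z, [/\ noncentric_biset Z, forall P f, n < #|P| -> f \in F P SG ->
       nfix (coprod_biset J Z) P f = nfix X P f & bad Z = set0].
  apply: (main _ Y (leqnn _)) => // Q f eQ _ hf; split; first exact: nfix_le_target.
  exact: target_mod.
elim: k Z => [|k IHk] Z.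
  by rewrite leqn0 cards_eq0 => /eqP Z0 nZ stZ _; exists Z.
have [Z0 _ nZ stZ _|[[Q f]]] := set_0Vmem (bad Z); first by exists Z.
rewrite inE /= => /and4P[/eqP eQ cQ hf nM] lek nZ stZ inv.
have jf := fhom_injhom hf; pose C := coset_biset jf.
have eC : (nfix C Q f * n)%N = #|'N(tdiag Q f)| by rewrite -eQ nfix_coset.
have n0 : 0 < n by rewrite -eQ cardG_gt0.
have [le_M eq_M] := inv Q f eQ cQ hf.
(* |N(Q, f)| is n times the number of points of [Q, f] fixed by (Q, f), so cancelling n leaves the
   number m of copies. The bound [le_M] makes the truncated subtraction exact. *)
have [m em] : exists m, (nfix (coprod_biset J Z) Q f + m * nfix C Q f = M Q)%N.
  have : #|'N(tdiag Q f)| %| (M Q - nfix (coprod_biset J Z) Q f) * n.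
    by rewrite mulnBl -eqn_mod_dvd ?leq_mul2r ?le_M ?orbT //; apply/eqP.
  rewrite -eC => /dvdnP[m em]; exists m.
  have /eqP : (M Q - nfix (coprod_biset J Z) Q f = m * nfix C Q f)%N.
    by apply/eqP; rewrite -(eqn_pmul2r n0) em mulnA.
  by move=> /eqP <-; rewrite subnKC.
pose Z' := coprod_biset Z (copies m C).
have nfE P g : nfix (coprod_biset J Z') P g =
    (nfix (coprod_biset J Z) P g + m * nfix C P g)%N.
  by rewrite !nfix_coprod nfix_copies addnA.
have big P g : n < #|P| -> nfix C P g = 0.
  move=> nP; apply/eqP; rewrite -leqn0 leqNgt; apply/negP=> /nfix_coset_gt0[u].
  by move=> /subset_leq_card; rewrite cardJg !card_tdiag eQ leqNgt nP.
(* At order n the new copies affect only the conjugates of (Q, f) in S x S. These have the same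
   count as (Q, f), so they reach their target at the same time. *)
have same P g : #|P| = n -> g \in F P SG ->
    nfix (coprod_biset J Z') P g = nfix (coprod_biset J Z) P g \/
    nfix (coprod_biset J Z') P g = M P /\ fisomorphic F P Q.
  move=> eP hg; have [C0|/nfix_coset_gt0[u sPQ]] := posnP (nfix C P g).
    by left; rewrite nfE C0 muln0 addn0.
  right; have eT : tdiag P g = tdiag Q f :^ u.
    by apply/eqP; rewrite eqEcard sPQ cardJg !card_tdiag eQ eP /=.
  have [h hh eh] := tdiagJ u hf; rewrite eh in eT.
  have [eP' _] := tdiag_inj (fhom_injhom hg) (fhom_injhom hh) eT.
  have QP : fisomorphic F P Q by rewrite eP' fiso_sym; apply: fisoJ.
  rewrite -eh in eT.
  by rewrite (nfix_conj _ eT) nfE em (target_eq QP).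
apply: (IHk Z').
- rewrite -ltnS; apply: leq_trans lek; apply: proper_card; apply/properP; split.
    apply/subsetP=> -[P g]; rewrite !inE /= => /and4P[/eqP eP cP hg nM'].
    rewrite eP eqxx cP hg /=; apply/negP=> /eqP e; case/negP: nM'.
    by case: (same P g eP hg) => [->|[-> _]]; apply/eqP; [exact: e | exact: erefl].
  exists (Q, f); first by rewrite inE /= eQ eqxx cQ hf.
  by rewrite inE /= nfE em eqxx !andbF.
- apply: noncentric_coprod nZ _; apply: noncentric_copies.
  exact: noncentric_coset jf hf cQ.
- by move=> P g nP hg; rewrite nfE (big _ _ nP) muln0 addn0 stZ.
move=> P g eP cP hg.
case: (same P g eP hg) => [->|[-> _]]; first exact: inv P g eP cP hg.
by split; [exact: leqnn | exact: erefl].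
Qed.

End Step.

Lemma exists_completion : exists2 Y, noncentric_biset Y &
  stable_above F (coprod_biset J Y) 0.
Proof.
(* The threshold starts at |S|, which no subgroup exceeds, so the empty biset will do; it goes down
   to 0, which every order exceeds. *)
suff H k : exists2 Y, noncentric_biset Y &
    stable_above F (coprod_biset J Y) (#|[set: S]| - k).
  by have := H #|[set: S]|; rewrite subnn.
elim: k => [|k [Y nY stY]].
  exists (empty_biset S); first by case.
  by move=> P Q f g; rewrite subn0 ltnNge subset_leq_card ?subsetT.
have [Z nZ stZ] := completion_step nY stY; exists Z => // P Q f g lt.
by apply: stZ; apply: leq_trans lt; rewrite subnS leqSpred.
Qed.

(** For f outside [F] both counts are 0: no stabilizer contains (P, f), and the composite with
    isomorphisms of [F] is outside [F] as well, since they can be undone. *)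
Lemma stable_fstable Z : fgenerated F Z -> stable_above F Z 0 -> fstable F Z.
Proof.
move=> gZ stZ P f R Q T e1 e2 hf eR h1 h2.
have [e1' [h1' c1 c1']] := isos_inv h1; have [e2' [h2' c2 c2']] := isos_inv h2.
have fR x : x \in P -> f x \in R by move=> Px; rewrite -eR imset_f.
have e1P x : x \in Q -> e1 x \in P by apply: injhom_sub (isos_injhom h1).
have [hF|nF] := boolP (f \in F P SG).
  apply: stZ => //; first by rewrite fiso_sym; apply: fiso_isos h1.
  apply: fhom_codomT (fhom_comp (fhom_comp (isos_fhom h1) _) (isos_fhom h2)).
  by apply: fhom_codom hF _; rewrite eR.
have z0 U h : h \in injhom U SG -> h \notin F U SG -> nfix Z U h = 0.
  move=> hh nh; apply/eqP; rewrite -leqn0 leqNgt; apply: contra nh.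
  exact: nfix_gt0_fhom.
rewrite !z0 //.
  have j1 := isos_injhom h1; have j2 := isos_injhom h2.
  apply/injhomP; split.
  - move=> x y Qx Qy; rewrite !ffunE (injhomM j1) // (injhomM hf) ?e1P //.
    by rewrite (injhomM j2) ?fR ?e1P.
  - move=> x y Qx Qy; rewrite !ffunE => e; apply: (injhom_inj j1) => //.
    by apply: (injhom_inj hf); rewrite ?e1P //; apply: (injhom_inj j2); rewrite ?fR ?e1P.
  - exact: subsetT.
  by move=> x nQx; rewrite !ffunE (injhom_out j1 nQx) (injhom1 hf) (injhom1 j2).
apply: contra nF => hF.
have hT : hcomp e2 (hcomp f e1) \in F Q T.
  apply: fhom_codom hF _; apply/subsetP=> _ /imsetP[x Qx ->].
  by rewrite !ffunE (injhom_sub (isos_injhom h2)) ?fR ?e1P.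
have := fhom_comp (fhom_comp (isos_fhom h1') hT) (isos_fhom h2').
move=> h; rewrite -[f](_ : hcomp e2' (hcomp (hcomp e2 (hcomp f e1)) e1') = f).
  exact: fhom_codomT h.
apply: injhom_eq (fhom_injhom h) hf _ => x Px.
by rewrite !ffunE c1' // c2 ?fR.
Qed.

End Completion.

(** * The centric part of a characteristic biset *)

Section CentricPart.
Variables (p : nat) (S : finGroupType) (F : fusion_system S).
Implicit Types (P Q R : {group S}) (f g : {ffun S -> S}) (W : biset S).
Local Notation SG := [set: S]%G.

(** An equivariant bijection sends the coset D to a point with stabilizer D. Conversely, from such a
    point [w0], the coset of u is sent to [w0] acted on by u^-1, the inversion relating left cosets
    to the right action [bact]. *)
Lemma orbit_isoP W (w : W) (D : {group S * S}) :
  reflect (exists v, 'C[bact W w v | bact W] = D) (orbit_iso w D).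
Proof.
have LP (X : {set S * S}) : X \in lcosets D [set: S * S] ->
    exists2 u, u \in X & X = u *: D.
  by case/lcosetsP=> u _ ->; exists u; rewrite ?lcoset_refl.
have DL u : u *: D \in lcosets D [set: S * S] by apply/lcosetsP; exists u; rewrite ?inE.
apply: (iffP existsP) => [[h /and3P[inj /eqP im /forallP act]]|[v ev]].
  have hin u v : h (u *: D) = h (v *: D) -> u *: D = v *: D.
    move=> /eqP e; apply/eqP; move/forall_inP: inj => /(_ _ (DL u)).
    by move/forall_inP=> /(_ _ (DL v))/implyP; apply.
  have D1 : D :=: 1 *: D by rewrite mul1g.
  have : h D \in orbit (bact W) [set: S * S] w.
    by rewrite -im; apply: imset_f; have := DL 1; rewrite -D1.
  case/orbitP=> v _ ev; exists v; apply/setP=> u; rewrite ev.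
  have := forall_inP (act u) _ (DL 1); rewrite -D1 => /eqP hu.
  rewrite -groupV; apply/astab1P/idP => [e|Du].
    have : h (u *: D) = h (1 *: D).
      by rewrite hu -D1 -[RHS]e /= /bact_fun /= invgK.
    by move/hin; rewrite mul1g => <-; apply: lcoset_refl.
  by rewrite /= /bact_fun /= invgK -hu lcoset_id.
pose w0 := bact W w v.
have key u d : u \in d *: D -> bact W w0 u^-1 = bact W w0 d^-1.
  move=> du; apply/eqP; rewrite bact_eq ev invgK -groupV invMg invgK.
  by rewrite -mem_lcoset.
pose h : {ffun {set S * S} -> W} := [ffun X : {set S * S} => bact W w0 (repr X)^-1].
have hE u : h (u *: D) = bact W w0 u^-1.
  by rewrite ffunE; apply: key; apply: mem_repr (lcoset_refl _ u).
exists h; apply/and3P; split.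
- apply/forall_inP=> _ /LP[u _ ->]; apply/forall_inP=> _ /LP[t _ ->].
  rewrite !hE bact_eq ev invgK -groupV invMg invgK -mem_lcoset.
  by apply/implyP=> /lcoset_eqP->.
- apply/eqP/setP=> x; apply/imsetP/orbitP=> [[_ /LP[u _ ->] ->]|[u _ <-]].
    by exists (v * u^-1); rewrite ?inE // hE actM.
  exists ((u^-1 * v) *: D); first exact: DL.
  by rewrite hE invMg invgK -actM mulKVg.
apply/forallP=> u; apply/forall_inP=> _ /LP[t _ ->].
rewrite -lcosetM !hE invMg actM /=.
by rewrite {1}/bact_fun /= invgK.
Qed.

(** Along an orbit the stabilizers are the conjugates of (P, f); their sources are conjugates of P,
    so centricity can be read off at any point. *)
Lemma noncentric_pointE W (w : W) P f : f \in F P SG ->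
  'C[w | bact W] = tdiag P f -> noncentric_point F w = ~~ centric F P.
Proof.
move=> hf ew; apply/idP/idP.
  case/existsP=> Q /existsP[g /and3P[cQ hg]].
  move=> /(@orbit_isoP _ _ (Group (tdiag_group_set hg)))[v] /=.
  rewrite astab1_act ew; have [k hk ->] := tdiagJ v hf => e.
  have [eQ _] := tdiag_inj (fhom_injhom hk) hg e.
  apply/negP=> cP; case/negP: cQ; rewrite -eQ; exact: centricJ.
move=> cP; apply/existsP; exists P; apply/existsP; exists f.
have jf := fhom_injhom hf; apply/and3P; split; [exact: cP | exact: jf |].
apply/(@orbit_isoP _ _ (Group (tdiag_group_set jf))); exists 1.
by rewrite act1.
Qed.

Lemma centric_part_stab W (w : centric_part F W) :
  'C[w | bact (centric_part F W)] = 'C[val w | bact W].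
Proof.
by apply/setP=> u; rewrite !mem_stab -val_eqE.
Qed.

Lemma card_centric_part W :
  #|centric_part F W| = #|[set w : W | ~~ noncentric_point F w]|.
Proof. by rewrite cardsE; apply: card_sig. Qed.

Hypotheses (pp : prime p) (pS : p.-group [set: S]).

Lemma centric_part_degree W : fgenerated F W ->
  degree_prime_to_p p W <-> degree_prime_to_p p (centric_part F W).
Proof.
move=> gW; rewrite {2}/degree_prime_to_p card_centric_part.
apply: degree_setC; apply: card_proper_points => // [a w b|w].
  rewrite 2!in_setC 2!in_set.
  exact: (congr1 negb (noncentric_point_act F a w b)).
rewrite !inE negbK => nw; have [P [f [hf ew]]] := gW w.
exists P, f; split; [exact: fhom_injhom hf | | exact: ew].
rewrite properEneq subsetT andbT; apply/eqP=> eP.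
move: nw; rewrite (noncentric_pointE hf ew) => /negP[].
by have -> : P = SG; [apply: val_inj | apply: centricT].
Qed.

Lemma fcharacteristic_centric_part W : fcharacteristic p F W ->
  centric_characteristic p F (centric_part F W).
Proof.
case=> gW stW dW; have cw (w : centric_part F W) : exists P f,
    [/\ centric F P, f \in F P SG & 'C[w | bact _] = tdiag P f].
  have [P [f [hf ew]]] := gW (val w); exists P, f.
  rewrite centric_part_stab; split; [|exact: hf|exact: ew].
  by have := valP w; rewrite /= (noncentric_pointE hf ew) negbK.
(* A point fixed by (P, f) has a source containing the centric P; it is therefore centric, and the
   point survives in the centric part. *)
have nfE P f : centric F P -> f \in F P SG ->
    nfix (centric_part F W) P f = nfix W P f.
  move=> cP hf; rewrite /nfix.
  rewrite -[LHS](card_imset (f := val : centric_part F W -> _) _ val_inj).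
  apply: eq_card => w; apply/imsetP/idP=> [[v Fv ->]|Fw].
    by rewrite mem_fix -centric_part_stab -mem_fix.
  have nw : ~~ noncentric_point F w.
    have [Q [g [hg ew]]] := gW w; rewrite (noncentric_pointE hg ew) negbK.
    move: Fw; rewrite mem_fix ew (tdiag_sub (fhom_injhom hf) (fhom_injhom hg)).
    by case/andP=> PQ _; exact: centric_over cP PQ.
  pose v : centric_part F W := exist (fun x => ~~ noncentric_point F x) w nw.
  exists v; last by [].
  by rewrite mem_fix centric_part_stab -mem_fix.
split.
- by move=> w; have [P [f [_ hf ew]]] := cw w; exists P, f.
- move=> w; have [P [f [cP hf ew]]] := cw w; exists P, f.
  by split; [exact: cP | exact: fhom_injhom hf | exact: ew].
- move=> P f cP hf; have jf := fhom_injhom hf; have [R [eR _ iso]] := fhom_im hf.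
  have [hv c1 c2] := isos_hinv iso.
  have cR := centric_fiso (fiso_isos iso) cP.
  have hi := fhom_codomT (fhom_incl F (subxx P)).
  rewrite eR (nfE _ _ cP hf) (nfE _ _ cP hi) (nfE _ _ cR (fhom_codomT (isos_fhom hv))).
  split.
    (* Composing f with its inverse f(P) -> P turns it into the inclusion of P. *)
    rewrite (stW P f R P P (hincl P) (hinv P f) jf eR (isos_incl F P) hv).
    congr (nfix W P _); apply/ffunP=> x; rewrite !ffunE.
    case: (boolP (x \in P)) => Px; first by rewrite -[RHS](c1 x Px) ffunE.
    have := injhom1 (isos_injhom hv); rewrite ffunE (injhom1 jf).
    exact.
  (* Precomposing the inclusion of P with the inverse f(P) -> P turns it into that inverse. *)
  have iP : hincl P @: P = P by apply: isos_im (isos_incl F P).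
  rewrite (stW P (hincl P) P R P (hinv P f) (hincl P) (fhom_injhom hi) iP hv
    (isos_incl F P)).
  congr (nfix W R _); apply/ffunP=> y; rewrite [LHS]ffunE [X in hincl P X]ffunE.
  have hvP : hinv P f y \in P.
    case: (boolP (y \in R)) => Ry; first exact: injhom_sub (isos_injhom hv) Ry.
    by rewrite (injhom_out (isos_injhom hv) Ry) group1.
  by rewrite [X in hincl P X]ffunE hvP ffunE hvP.
by apply/(centric_part_degree gW).
Qed.

End CentricPart.

(** * Comparison with the minimal characteristic biset *)

Section Main.
Variables (p : nat) (S : finGroupType) (F : fusion_system S) (L : linking_system F).
Local Notation SG := [set: S]%G.
Local Notation J := (nonext_biset L).
Hypotheses (pp : prime p) (pS : p.-group [set: S]) (satF : saturated F p).

Lemma embedding_stab (X Y : biset S) (h : X -> Y) (x : X) :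
  biset_morphism h -> injective h -> 'C[h x | bact Y] = 'C[x | bact X].
Proof.
move=> hm hi; apply/setP=> u.
have e : h (bact X x u) = bact Y (h x) u by apply: hm.
apply/astab1P/astab1P=> [E|E]; last by rewrite -e E.
by apply: hi; rewrite e.
Qed.

Lemma exists_fcharacteristic_coprod :
  exists2 Y, noncentric_biset F Y & fcharacteristic p F (coprod_biset J Y).
Proof.
have gJ := nonext_fgenerated satF (L := L).
have [|Y nY stY] := exists_completion pS satF gJ.
  move=> P Q f g cP PQ hf hg; have cQ := centric_fiso PQ cP.
  rewrite (nfix_nonext L pS satF cP hf) (nfix_nonext L pS satF cQ hg).
  exact: fiso_card_center PQ.
have gV : fgenerated F (coprod_biset J Y).
  exact: coprod_fgenerated gJ (noncentric_fgenerated nY).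
exists Y => //; split; [exact: gV | exact: stable_fstable gV stY |].
have inlI : injective (@inl J Y) by move=> x y [].
pose A : {set coprod_biset J Y} := [set inl j | j in [set: J]].
have cA : #|A| = #|J| by rewrite card_imset // cardsT.
have inA (j : J) : (inl j : coprod_biset J Y) \in A by apply: imset_f; rewrite inE.
have ninA (y : Y) : (inr y : coprod_biset J Y) \in A = false.
  by apply/negbTE/imsetP=> -[].
(* S is centric, so the added noncentric orbits have proper sources and do not change the degree
   modulo p. *)
have dA : (p * #|[set: S]|)%N %| #|~: A|.
  apply: card_proper_points => // [a [j|y] b|[j|y]].
  - by rewrite /= !inE !inA.
  - by rewrite /= !inE !ninA.
  - by rewrite inE inA.
  move=> _; have [Q [f [cQ hf e]]] := nY y; exists Q, f; split.
  - exact: fhom_injhom hf.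
  - rewrite properEneq subsetT andbT; apply/eqP=> eQ; case/negP: cQ.
    by have -> : Q = SG; [apply: val_inj | apply: centricT].
  by rewrite -e; apply: coprod_stab_r.
apply/(degree_setC dA); rewrite cA; exact: (nonext_degree L pp pS satF).
Qed.

(** An embedding preserves stabilizers, so a centric point of [Lambda] cannot land among the added
    noncentric orbits and must land in [J]. *)
Lemma card_minimal_centric_part (Lambda : biset S) :
  minimal_biset (fcharacteristic p F) Lambda ->
  #|centric_part F Lambda| <= #|J|.
Proof.
case=> -[gL _ _] minL; have [Y nY /minL[h hm hi]] := exists_fcharacteristic_coprod.
pose k (w : centric_part F Lambda) := h (val w).
have ki : injective k by move=> w w' /hi/val_inj.
have kJ w : k w \in [set inl j | j in [set: J]].
  rewrite /k; case e: (h (val w)) => [j|y]; first by rewrite imset_f ?inE.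
  have [P [f [hf ew]]] := gL (val w); have [Q [g [cQ hg ey]]] := nY y.
  have := embedding_stab (val w) hm hi.
  rewrite e ew (coprod_stab_r J y) ey => eT.
  have [eQ _] := tdiag_inj (fhom_injhom hg) (fhom_injhom hf) eT.
  have := valP w; rewrite /= (noncentric_pointE hf ew) negbK => cP.
  by case/negP: cQ; rewrite eQ.
rewrite -cardsT -(card_imset _ ki) -[#|J|]cardsT -(card_imset [set: J] (@inl_inj J Y)).
by apply: subset_leq_card; apply/subsetP=> _ /imsetP[w _ ->].
Qed.

End Main.

Theorem theoremC (p : nat) (S : finGroupType) (F : fusion_system S)
    (L : linking_system F) :
  prime p -> (p.-group [set: S])%g -> saturated F p ->
  [/\ centric_characteristic p F (nonext_biset L),
      minimal_biset (centric_characteristic p F) (nonext_biset L),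
      (forall W : biset S, minimal_biset (centric_characteristic p F) W ->
         biset_iso (nonext_biset L) W)
    & (forall Lambda : biset S, minimal_biset (fcharacteristic p F) Lambda ->
         biset_iso (nonext_biset L) (centric_part F Lambda))].
Proof.
move=> pp pS satF; have cJ := nonext_centric_characteristic L pp pS satF.
split; [exact: cJ | split; [exact: cJ|] | |].
- by move=> V; apply: nonext_embeds.
- move=> W [cW minW]; have le := embeds_card (minW _ cJ); apply: embeds_iso le.
  exact: (nonext_embeds L pS satF cW).
move=> Lambda mL; have le := card_minimal_centric_part L pp pS satF mL.
apply: embeds_iso le; apply: (nonext_embeds L pS satF).
case: mL => cL _; exact (fcharacteristic_centric_part pS cL).
Qed.
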